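(* Let $T\in(0,\infty)$, and let $\mu_T$, $\mu_T^{(N)}$ ($N\in\mathbb{N}$) and $\nu_k^{\Delta t}$ ($k\in\mathbb{N}_0$, $\Delta t\in(0,1)$) be the probability distributions on $H=L^2(0,1)$ defined in the context. Then \[ \limsup_{N\to\infty}\ \lambda_N^{r}\sup_{\phi\in\mathcal{C}^{0,1}(H,\mathbb{R}),\ \|\phi\|_1\le 1}\Big|\int_H\phi\,d\mu_T-\int_H\phi\,d\mu_T^{(N)}\Big|=\begin{cases}0 & \text{for all } r\in[0,\tfrac14),\\ \infty & \text{for all } r\in(\tfrac14,\tfrac12),\end{cases} \] and \[ \limsup_{\Delta t\to 0}\ \frac{1}{\Delta t^{r}}\sup_{\phi\in\mathcal{C}^{0,1}(H,\mathbb{R}),\ \|\phi\|_1\le 1}\Big|\int_H\phi\,d\mu_T-\int_H\phi\,d\nu_{\lfloor T/\Delta t\rfloor}^{\Delta t}\Big|=\begin{cases}0 & \text{for all } r\in[0,\tfrac14),\\ \infty & \text{for all } r\in(\tfrac14,\tfrac12).\end{cases} \]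
   Context: Let $H=L^2(0,1)$ with inner product $\langle\cdot,\cdot\rangle$ and norm $|\cdot|$. For $n\in\mathbb{N}=\{1,2,\ldots\}$ let $\lambda_n=\pi^2n^2$ and $e_n=\sqrt2\sin(n\pi\,\cdot)$, a complete orthonormal system of $H$. Let $A$ be the self-adjoint operator $Ax=-\sum_{n}\lambda_n\langle x,e_n\rangle e_n$ on $D(A)=\{x\in H:\sum_n\lambda_n^2\langle x,e_n\rangle^2<\infty\}$ (Dirichlet Laplacian), generating the semigroup $e^{tA}x=\sum_n e^{-\lambda_nt}\langle x,e_n\rangle e_n$. Let $(\beta_n)_{n\in\mathbb{N}}$ be independent standard real Wiener processes on a probability space and $W(t)=\sum_n\beta_n(t)e_n$ the cylindrical Wiener process. Let $X(t)=\int_0^te^{(t-s)A}dW(s)=\sum_n\big(\int_0^te^{-\lambda_n(t-s)}d\beta_n(s)\big)e_n$ be the mild solution of $dX=AX\,dt+dW$, $X(0)=0$, and let $\mu_t$ denote the law of $X(t)$ (a centered Gaussian measure on $H$ with covariance $Q_te_n=\frac{1}{2\lambda_n}(1-e^{-2\lambda_nt})e_n$). Spectral Galerkin discretization: for $N\in\mathbb{N}$, $P_N$ is the orthogonal projection onto $\mathrm{Span}(e_1,\ldots,e_N)$, $X^{(N)}(t)=P_NX(t)$ (the solution of $dX^{(N)}=AX^{(N)}dt+P_NdW$, $X^{(N)}(0)=0$), and $\mu_t^{(N)}$ is the law of $X^{(N)}(t)$. Linear implicit Euler scheme: for $\Delta t\in(0,1)$, let $S_{\Delta t}=(I-\Delta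 tA)^{-1}$, $X_0^{\Delta t}=0$, $X_{k+1}^{\Delta t}=S_{\Delta t}X_k^{\Delta t}+S_{\Delta t}\big(W((k+1)\Delta t)-W(k\Delta t)\big)$ for $k\in\mathbb{N}_0$, and $\nu_k^{\Delta t}$ is the law of $X_k^{\Delta t}$ (centered Gaussian with covariance $\Delta t\sum_{\ell=0}^{k-1}S_{\Delta t}^{2(k-\ell)}$). $\mathcal{C}^{0,1}(H,\mathbb{R})$ denotes the bounded Lipschitz continuous functions $H\to\mathbb{R}$, with $\|\phi\|_1=\sup_{x\in H}|\phi(x)|+\sup_{x\ne y}\frac{|\phi(y)-\phi(x)|}{|y-x|}$. *)

(* Defs.v *)
From HB Require Import structures.
From mathcomp Require Import all_boot all_order all_algebra.
From mathcomp Require Import all_classical all_reals all_analysis.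
From mathcomp Require Import normal_distribution.
Set Implicit Arguments. Unset Strict Implicit. Unset Printing Implicit Defensive.
Import Order.TTheory GRing.Theory Num.Theory.
Import numFieldNormedType.Exports.
Local Open Scope classical_set_scope.
Local Open Scope ring_scope.

Section Defs.
Context {R : realType}.
Local Notation leb := (@lebesgue_measure R).

(* eigenvalues lambda_n = pi^2 n^2 of -A and eigenfunctions e_n = sqrt 2 sin(n pi .) *)
Definition lam (n : nat) : R := pi ^+ 2 * (n%:R) ^+ 2.
Definition efun (n : nat) (x : R) : R := Num.sqrt 2 * sin (n%:R * pi * x).

(* H = L^2(0,1): elements are represented by measurable square-integrable
   functions on [0,1]; two representatives at L2 distance 0 are the same
   element of H. *)
Definition inH (f : R -> R) : Prop :=
  measurable_fun (`[0%R, 1%R] : set R) f /\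
  (\int[leb]_(x in `[0%R, 1%R]) ((f x) ^+ 2)%:E < +oo)%E.

Definition L2dist (f g : R -> R) : R :=
  Num.sqrt (fine (\int[leb]_(x in `[0%R, 1%R]) (((f x - g x) ^+ 2)%:E))).

Definition BL1 (phi : (R -> R) -> R) : Prop :=
  exists M L : R, [/\ 0 <= M, 0 <= L, M + L <= 1,
    (forall f, inH f -> `|phi f| <= M) &
    (forall f g, inH f -> inH g -> `|phi f - phi g| <= L * L2dist f g)].

(* eigenvalues of the covariance Q_T of mu_T *)
Definition qT (T : R) (n : nat) : R :=
  (1 - expR (- (2 * lam n * T))) / (2 * lam n).

(* eigenvalues of the covariance  dt * sum_{l<k} S_dt^(2(k-l))  of nu_k^dt *)
Definition vEuler (dt : R) (k : nat) (n : nat) : R :=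
  dt * \sum_(l < k) ((1 + dt * lam n)^-1) ^+ (2 * (k - l)).

Definition psum {d} {Omega : measurableType d} (sigma : nat -> R)
    (xi : nat -> Omega -> R) (M : nat) (w : Omega) : R -> R :=
  fun x => \sum_(1 <= n < M.+1) Num.sqrt (sigma n) * xi n w * efun n x.

Definition iid_std_normal {d} {Omega : measurableType d}
    (P : probability Omega R) (xi : nat -> Omega -> R) : Prop :=
  (forall n, measurable_fun setT (xi n)) /\
  (forall n (A : set R), measurable A ->
      P (xi n @^-1` A) = normal_prob 0 1 A) /\
  (forall (F : seq nat) (A : nat -> set R), uniq F ->
      (forall i, measurable (A i)) ->
      P (\bigcap_(i in [set` F]) (xi i @^-1` A i)) =
      (\prod_(i <- F) P (xi i @^-1` A i))%E).

(* Y is (a version of) the H-valued random variable sum_n sqrt(sigma_n) xi_n e_n,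
   the series converging in H = L^2(0,1) almost surely.  Its law is the centered
   Gaussian measure on H with covariance  e_n |-> sigma_n e_n. *)
Definition series_version {d} {Omega : measurableType d}
    (P : probability Omega R) (xi : nat -> Omega -> R) (sigma : nat -> R)
    (Y : Omega -> R -> R) : Prop :=
  {ae P, forall w, inH (Y w) /\
     (fun M => L2dist (psum sigma xi M w) (Y w)) @ \oo --> (0 : R)}.

Definition expect {d} {Omega : measurableType d} (P : probability Omega R)
    (phi : (R -> R) -> R) (Y : Omega -> R -> R) : R :=
  fine (\int[P]_w (phi (Y w))%:E).

Definition dBL {d} {Omega : measurableType d} (P : probability Omega R)
    (Y Z : Omega -> R -> R) : R :=
  sup [set `|expect P phi Y - expect P phi Z| | phi in BL1].

End Defs.

(* Main.v *)
(** All the laws are coupled through the same Gaussian coordinates [xi n].  Upper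
    bounds: a functional with Lipschitz constant at most 1 sees at most
    [E |Y - Z| <= (sum (sqrt s_n - sqrt s'_n)^2)^(1/2)], and this sum is
    [O(1/N)] for the Galerkin truncation and, since
    [(sqrt s - sqrt s')^2 <= |s - s'|], [O(sqrt dt)] for the Euler scheme.
    Lower bounds: the sup is taken inside the limit, so the test functional may
    depend on the discretization.  On a block of [m] modes take
    [phi f = (2 sqrt m)^-1 * sum_n min (|<f, e_n>|, 1 / sqrt m)]; by
    Cauchy-Schwarz it is Lipschitz although it adds [m] coordinates, and it
    gains a factor [sqrt m] over any single mode.  With [m] of order [N],
    resp. [dt^(-1/2)], every mode of the block carries an error of order
    [1 / m], which yields [m^(-1/2)]. *)

Require Import Defs.
From HB Require Import structures.
From mathcomp Require Import all_boot all_order all_algebra.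
From mathcomp Require Import all_classical all_reals all_analysis.
From mathcomp Require Import measurable_realfun normal_distribution ring lra.
Set Implicit Arguments. Unset Strict Implicit. Unset Printing Implicit Defensive.
Import Order.TTheory GRing.Theory Num.Theory.
Import numFieldNormedType.Exports.
Local Open Scope classical_set_scope.
Local Open Scope ring_scope.

(** * L2(0,1) and the sine basis *)

Section L2.
Context {R : realType}.
Local Notation leb := (@lebesgue_measure R).
Local Notation D := [set` `[(0:R)%R, 1%R]].
Implicit Types f g h : R -> R.

(** Both distances turn out to lie between two multiples of the fourth root of a small parameter
    [t], with [t = 1 / lam N] for the truncation and [t = dt] for the Euler scheme. The dichotomy at
    1/4 is then the behaviour of [t ^ (1/4 - r)] as [t] tends to 0. For the Euler scheme the
    critical modes are those with [dt * lam n] of order one. Below them the variance error is about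
    [dt] per mode, above them it is comparable to the whole variance [1 / (2 lam n)]; both ranges
    contribute order [sqrt dt]. The lower bound therefore places its block at [n] of order
    [dt^(-1/2)]. A test functional is an arbitrary bounded Lipschitz map, and its composition with
    [Y] need not be measurable. Every estimate is made on partial sums, where the functional depends
    in a Lipschitz way on finitely many real coordinates, and then passed to the limit by dominated
    convergence. *)

Definition ip f g : R := \int[leb]_(x in D) (f x * g x).

Definition fsum (c : nat -> R) (M : nat) (x : R) : R :=
  \sum_(1 <= n < M.+1) c n * efun n x.

Lemma L2distE f g :
  L2dist f g = Num.sqrt (ip (fun x => f x - g x) (fun x => f x - g x)).
Proof. by []. Qed.

Lemma L2dist_ge0 f g : 0 <= L2dist f g.
Proof. exact: sqrtr_ge0. Qed.

Lemma inH_sqr_integrable f : inH f ->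
  leb.-integrable D (EFin \o (fun x => f x ^+ 2)).
Proof.
move=> [mf If]; apply/integrableP; split.
  by apply/measurable_EFinP; exact: measurable_funX.
rewrite (@eq_integral _ _ _ leb D (fun x => ((f x) ^+ 2)%:E)) // => x _ /=.
by rewrite ger0_norm // sqr_ge0.
Qed.

Lemma inH_mul_integrable f g : inH f -> inH g ->
  leb.-integrable D (EFin \o (fun x => f x * g x)).
Proof.
move=> Hf Hg; have [mf _] := Hf; have [mg _] := Hg.
apply: (@le_integrable _ _ _ leb D _ _
  (EFin \o (fun x => f x ^+ 2 + g x ^+ 2))) => //.
- by apply/measurable_EFinP; exact: measurable_funM.
- move=> x _ /=; rewrite lee_fin [leRHS]ger0_norm ?addr_ge0 ?sqr_ge0 //.
  have := sqr_ge0 (`|f x| - `|g x|); have := sqr_ge0 (`|f x| + `|g x|).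
  by rewrite normrM -(real_normK (num_real (f x))) -(real_normK (num_real (g x))); nra.
- rewrite (_ : EFin \o _ =
    (fun x => (f x ^+ 2)%:E) \+ (fun x => (g x ^+ 2)%:E))%E //.
  by apply: integrableD => //; exact: inH_sqr_integrable.
Qed.

Lemma inHD f g : inH f -> inH g -> inH (fun x => f x + g x).
Proof.
move=> Hf Hg; have [mf If] := Hf; have [mg Ig] := Hg.
split; first exact: measurable_funD.
have i2 : leb.-integrable D (EFin \o (fun x => 2 * f x ^+ 2 + 2 * g x ^+ 2)).
  rewrite (_ : EFin \o _ = (fun x => 2%:E * (f x ^+ 2)%:E)
     \+ (fun x => 2%:E * (g x ^+ 2)%:E))%E; last first.
    by apply/funext => x /=; rewrite EFinD !EFinM.
  by apply: integrableD => //; apply: integrableZl => //;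
     exact: inH_sqr_integrable.
have /integrableP[_] := i2; apply: le_lt_trans.
apply: ge0_le_integral => //.
- by move=> x _; rewrite lee_fin sqr_ge0.
- by apply/measurable_EFinP; apply: measurable_funX; exact: measurable_funD.
- by apply: measurableT_comp => //; case/integrableP: i2.
- move=> x _ /=; rewrite lee_fin ger0_norm; last first.
    by rewrite addr_ge0 // mulr_ge0 // sqr_ge0.
  by have := sqr_ge0 (f x - g x); nra.
Qed.

Lemma inHZ a f : inH f -> inH (fun x => a * f x).
Proof.
move=> Hf; have [mf If] := Hf; split.
  by apply: measurable_funM => //; exact: measurable_cst.
rewrite (@eq_integral _ _ _ leb D (fun x => (a ^+ 2)%:E * ((f x) ^+ 2)%:E)%E); last first.
  by move=> x _; rewrite exprMn EFinM.
rewrite ge0_integralZl //.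
- by apply: lte_mul_pinfty => //; rewrite lee_fin sqr_ge0.
- by apply/measurable_EFinP; exact: measurable_funX.
- by move=> x _; rewrite lee_fin sqr_ge0.
- by rewrite lee_fin sqr_ge0.
Qed.

Lemma inHB f g : inH f -> inH g -> inH (fun x => f x - g x).
Proof.
move=> Hf /(inHZ (-1)) Hg; have := inHD Hf Hg.
by congr inH; apply/funext => x; rewrite mulN1r.
Qed.

Lemma continuous_inH f : continuous f -> inH f.
Proof.
move=> cf; split; first exact: measurable_funS (continuous_measurable_fun cf).
have cf2 : {within D, continuous (fun x => f x ^+ 2)}.
  apply: continuous_subspaceT => x.
  apply: (@continuous_comp _ _ _ f (fun y => y ^+ 2)); [exact: cf|exact: exprn_continuous].
have /integrableP[_] :=
  continuous_compact_integrable (@segment_compact _ 0 1) cf2.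
rewrite (@eq_integral _ _ _ leb D (fun x => ((f x) ^+ 2)%:E)) // => x _ /=.
by rewrite ger0_norm // sqr_ge0.
Qed.

Lemma ipC f g : ip f g = ip g f.
Proof. by apply: eq_Rintegral => x _; rewrite mulrC. Qed.

Lemma ipDl f g h : inH f -> inH g -> inH h ->
  ip (fun x => f x + g x) h = ip f h + ip g h.
Proof.
move=> Hf Hg Hh; rewrite /ip -RintegralD //; last 2 first.
- exact: inH_mul_integrable.
- exact: inH_mul_integrable.
by apply: eq_Rintegral => x _; rewrite mulrDl.
Qed.

Lemma ipZl a f h : inH f -> inH h -> ip (fun x => a * f x) h = a * ip f h.
Proof.
move=> Hf Hh; rewrite /ip -RintegralZl //; last exact: inH_mul_integrable.
by apply: eq_Rintegral => x _; rewrite mulrA.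
Qed.

Lemma ip_ge0 f : 0 <= ip f f.
Proof. by apply: Rintegral_ge0 => x _; rewrite -expr2 sqr_ge0. Qed.

Lemma ipBl f g h : inH f -> inH g -> inH h ->
  ip (fun x => f x - g x) h = ip f h - ip g h.
Proof.
move=> Hf Hg Hh; have := ipDl Hf (inHZ (-1) Hg) Hh.
rewrite ipZl // mulN1r => <-; congr ip.
by apply/funext => x; rewrite mulN1r.
Qed.

(** Cauchy-Schwarz against the unit ball; this form avoids dividing by the norm of [h]. *)
Lemma ip_le_sqrt u h : inH u -> inH h -> ip h h <= 1 ->
  ip u h <= Num.sqrt (ip u u).
Proof.
move=> Hu Hh h1.
have quad t : 0 <= ip u u - 2 * t * ip u h + t ^+ 2 * ip h h.
  have Hth : inH (fun x => t * h x) by exact: inHZ.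
  have Huth : inH (fun x => u x - t * h x) by exact: inHB.
  have := ip_ge0 (fun x => u x - t * h x).
  rewrite ipBl // (ipC u) (ipC (fun x => t * h x)) !ipBl // !ipZl //.
  rewrite (ipC u (fun x => t * h x)) (ipC h (fun x => t * h x)) !ipZl // (ipC h u); lra.
have [u0|u0] := leP (ip u h) 0; first exact: le_trans u0 (sqrtr_ge0 _).
rewrite -(ler_pXn2r (n := 2)) ?nnegrE ?sqrtr_ge0 ?(ltW u0) //.
rewrite sqr_sqrtr ?ip_ge0 //.
(* At [t = ip u h] the quadratic gives [(ip u h)^2 * (2 - ip h h) <= ip u u], and the second factor
   is at least 1. *)
have := quad (ip u h); nra.
Qed.

Lemma ip_le_L2 f g h : inH f -> inH g -> inH h -> ip h h <= 1 ->
  ip f h - ip g h <= L2dist f g.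
Proof.
move=> Hf Hg Hh h1; rewrite -ipBl // L2distE.
by apply: ip_le_sqrt => //; exact: inHB.
Qed.

Lemma efun_inH n : inH (@efun R n).
Proof.
apply: continuous_inH => x; apply: cvgM; first exact: cvg_cst.
apply: continuous_comp; last exact: continuous_sin.
by apply: cvgM; [exact: cvg_cst|exact: cvg_id].
Qed.

Lemma fsumS c M :
  fsum c M.+1 = (fun x => fsum c M x + c M.+1 * efun M.+1 x).
Proof. by apply/funext => x; rewrite /fsum big_nat_recr. Qed.

Lemma fsum0 c : fsum c 0 = cst 0.
Proof. by apply/funext => x; rewrite /fsum big_geq. Qed.

Lemma fsum_inH c M : inH (fsum c M).
Proof.
elim: M => [|M IH]; last by rewrite fsumS; apply: inHD => //; apply: inHZ; exact: efun_inH.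
by rewrite fsum0; apply: continuous_inH => x; exact: cst_continuous.
Qed.

Lemma ip_fsuml c M h : inH h ->
  ip (fsum c M) h = \sum_(1 <= n < M.+1) c n * ip (efun n) h.
Proof.
move=> Hh; elim: M => [|M IH].
  rewrite fsum0 big_geq // /ip.
  rewrite (@eq_Rintegral _ _ _ leb D (fun=> 0)); last by move=> x _; rewrite mul0r.
  by rewrite Rintegral_cst // mul0r.
rewrite fsumS ipDl //; last 2 first.
- exact: fsum_inH.
- by apply: inHZ; exact: efun_inH.
rewrite IH ipZl // ?[RHS]big_nat_recr //; exact: efun_inH.
Qed.

Lemma sin_natpi (n : nat) : sin (n%:R * pi) = 0 :> R.
Proof.
elim: n => [|n IH]; first by rewrite mul0r sin0.
by rewrite -natr1 mulrDl mul1r sinDpi IH oppr0.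
Qed.

(** The frequency is a real number because it is also taken to be [m - n], which may be negative. *)
Lemma integral_cos (k : R) : k != 0 -> sin (k * pi) = 0 ->
  \int[leb]_(x in D) cos (k * pi * x) = 0.
Proof.
move=> k0 sk; have kpi : k * pi != 0 by rewrite mulf_neq0 // gt_eqF // pi_gt0.
have cc : continuous (fun x : R => cos (k * pi * x)).
  move=> x; apply: continuous_comp; last exact: continuous_cos.
  by apply: cvgM; [exact: cvg_cst|exact: cvg_id].
have dF (x : R) : is_derive x 1 (fun x : R => sin (k * pi * x) / (k * pi)) (cos (k * pi * x)).
  have -> : (fun x : R => sin (k * pi * x) / (k * pi)) =
     (k * pi)^-1 \*: (fun x : R => sin ((k * pi) *: x)).
    by apply/funext => y; rewrite /= mulrC.
  apply: is_derive_eq; rewrite /GRing.scale /= mulr1.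
  by move: kpi; set kp := k * pi => kp0; field.
have cF : continuous (fun x : R => sin (k * pi * x) / (k * pi)).
  move=> x; apply: differentiable_continuous.
  by apply/derivable1_diffP; have [] := dF x.
rewrite /Rintegral (@continuous_FTC2 _ _ (fun x : R => sin (k * pi * x) / (k * pi))) //.
- by rewrite mulr1 sk mul0r mulr0 sin0 mul0r subee.
- exact: continuous_subspaceT.
- split.
  + by move=> x _; have [] := dF x.
  + exact: (cvg_at_right_filter (cF 0)).
  + exact: (cvg_at_left_filter (cF 1)).
- by move=> x _; rewrite derive1E; have [_ ->] := dF x.
Qed.

Lemma ip_efun m n : (0 < m)%N -> (0 < n)%N ->
  ip (efun m) (efun n) = (m == n)%:R.
Proof.
move=> m0 n0; pose C (k : R) := fun x : R => cos (k * pi * x).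
have iC k : leb.-integrable D (EFin \o C k).
  apply: continuous_compact_integrable; first exact: segment_compact.
  apply: continuous_subspaceT => x; apply: continuous_comp; last exact: continuous_cos.
  by apply: cvgM; [exact: cvg_cst|exact: cvg_id].
have -> : ip (efun m) (efun n) =
    \int[leb]_(x in D) C (m%:R - n%:R) x - \int[leb]_(x in D) C (m%:R + n%:R) x.
  rewrite -RintegralB //; apply: eq_Rintegral => x _.
  rewrite /C /efun !mulrDl mulNr mulNr cosB cosD.
  rewrite mulrACA -expr2 sqr_sqrtr //; ring.
rewrite [X in _ - X]integral_cos; last 2 first.
- by rewrite -natrD pnatr_eq0 addn_eq0 negb_and -!lt0n m0.
- by rewrite -natrD sin_natpi.
rewrite subr0; have [->|mn] := eqVneq m n.
  rewrite (@eq_Rintegral _ _ _ leb D (fun=> 1)); last first.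
    by move=> x _; rewrite /C subrr !mul0r cos0.
  rewrite Rintegral_cst //= lebesgue_measure_itv /= lte_fin ltr01.
  by rewrite oppr0 adde0 mulr1.
rewrite integral_cos //; first by rewrite subr_eq0 eqr_nat.
by rewrite mulrBl sinB !sin_natpi !mul0r mulr0 subrr.
Qed.

Lemma ip_fsum_efun c M k : (0 < k)%N ->
  ip (fsum c M) (efun k) = if (k <= M)%N then c k else 0.
Proof.
move=> k0; rewrite ip_fsuml; last exact: efun_inH.
rewrite (eq_big_nat _ _ (F2 := fun n => if n == k then c n else 0)); last first.
  by move=> n /andP[n0 _]; rewrite ip_efun //; case: eqP; rewrite ?mulr1 ?mulr0.
by rewrite -big_mkcond big_nat1_eq k0 ltnS.
Qed.

Lemma ip_fsum c M : ip (fsum c M) (fsum c M) = \sum_(1 <= n < M.+1) c n ^+ 2.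
Proof.
rewrite ip_fsuml; last exact: fsum_inH.
apply: eq_big_nat => n /andP[n0 nM].
by rewrite ipC ip_fsum_efun // -ltnS nM expr2.
Qed.

Lemma L2dist_fsum c c' M : L2dist (fsum c M) (fsum c' M) =
  Num.sqrt (\sum_(1 <= n < M.+1) (c n - c' n) ^+ 2).
Proof.
rewrite L2distE -ip_fsum.
suff -> : (fun x => fsum c M x - fsum c' M x) = fsum (fun n => c n - c' n) M by [].
by apply/funext => x; rewrite /fsum -sumrB; apply: eq_bigr => n _; rewrite mulrBl.
Qed.

End L2.

(** * Standard normal variables *)

Section Density.
Context d (T : measurableType d) (R : realType).
Variables (mu nu : {measure set T -> \bar R}) (g : T -> R).
Hypotheses (mg : measurable_fun setT g) (g0 : forall x, 0 <= g x).
Hypothesis nuE : forall A, measurable A -> nu A = (\int[mu]_(x in A) (g x)%:E)%E.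

Import HBNNSimple.

Lemma integral_density_nnsfun (f : {nnsfun T >-> R}) :
  (\int[nu]_x (f x)%:E = \int[mu]_x ((f x)%:E * (g x)%:E))%E.
Proof.
rewrite integralT_nnsfun sintegralE.
under [RHS]eq_integral.
  move=> x _; rewrite fimfunE -fsumEFin// muleC ge0_mule_fsumr; last first.
    by move=> r; rewrite EFinM nnfun_muleindic_ge0.
  over.
rewrite ge0_integral_fsum//; last 2 first.
- move=> r; apply: emeasurable_funM; first exact/measurable_EFinP.
  by apply/measurable_EFinP; apply/measurableT_comp.
- move=> r x _; apply: mule_ge0; first by rewrite lee_fin.
  by rewrite EFinM nnfun_muleindic_ge0.
apply: eq_fsbigr => r; rewrite inE /= => -[t _ ftr].
have r0 : 0 <= r by rewrite -ftr.
rewrite nuE // integral_mkcond epatch_indic -ge0_integralZl //.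
- by apply: eq_integral => x _ /=; rewrite EFinM muleCA.
- apply: emeasurable_funM; first exact/measurable_EFinP.
  exact/measurable_EFinP/measurable_indic.
- by move=> x _ /=; rewrite mule_ge0 // lee_fin.
Qed.

(** Monotone convergence from simple functions. One inequality is enough to bound a second moment
    from above. *)
Lemma ge0_integral_density_le (f : T -> \bar R) :
  measurable_fun setT f -> (forall x, 0 <= f x)%E ->
  (\int[nu]_x f x <= \int[mu]_x (f x * (g x)%:E))%E.
Proof.
move=> mf f0; pose f_ := nnsfun_approx measurableT mf.
have f_cvg x : (EFin \o f_ ^~ x) @ \oo --> f x by exact: cvg_nnsfun_approx.
have f_nd x : {homo (fun n => (f_ n x)%:E) : m n / (m <= n)%N >-> (m <= n)%E}.
  by move=> m n mn; rewrite lee_fin; exact/lefP/nd_nnsfun_approx.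
have -> : (\int[nu]_x f x = limn (fun n => \int[nu]_x (f_ n x)%:E))%E.
  rewrite -monotone_convergence //=.
  - by apply: eq_integral => x _; apply/esym/cvg_lim => //; exact: f_cvg.
  - by move=> n; exact/measurable_EFinP/measurable_funTS.
  - by move=> n x _; rewrite lee_fin.
apply: lime_le.
  apply: ereal_nondecreasing_is_cvgn => m n mn; apply: ge0_le_integral => //=.
  - by move=> x _; rewrite lee_fin.
  - exact/measurable_EFinP/measurable_funTS.
  - exact/measurable_EFinP/measurable_funTS.
  - by move=> x _; exact: f_nd.
apply: nearW => n; rewrite integral_density_nnsfun; apply: ge0_le_integral => //=.
- by move=> x _; rewrite mule_ge0 // lee_fin.
- by apply: emeasurable_funM; exact/measurable_EFinP/measurable_funTS.
- by apply: emeasurable_funM => //; exact/measurable_EFinP.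
- move=> x _; apply: lee_wpmul2r; first by rewrite lee_fin.
  have fE := ereal_nondecreasing_cvgn (f_nd x).
  rewrite (cvg_unique _ (f_cvg x) fE) //; apply: ereal_sup_ubound.
  by exists n.
Qed.

End Density.

Section Gauss.
Context {R : realType}.
Local Notation leb := (@lebesgue_measure R).

(* [x ^+ 2 <= 4 * expR (3 / 8 * x ^+ 2)] dominates the integrand by a multiple of the
   normal density of standard deviation 2. *)
Lemma std_normal_sqr_le d (Omega : measurableType d) (P : probability Omega R)
    (X : Omega -> R) : measurable_fun setT X ->
  (forall A : set R, measurable A -> P (X @^-1` A) = normal_prob 0 1 A) ->
  (\int[P]_w ((X w) ^+ 2)%:E <= (4 * normal_peak 1 / normal_peak 2)%:E)%E.
Proof.
move=> mX lawX.
pose X' : Omega -> measurableTypeR R := X.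
have mX' : measurable_fun setT X' by move=> _ A mA; exact: mX.
pose sq (x : measurableTypeR R) : \bar R := ((x : R) ^+ 2)%:E.
have msq : measurable_fun setT sq.
  by apply/measurable_EFinP; apply: measurable_funX; exact: measurable_id.
have -> : (\int[P]_w (X w ^+ 2)%:E = \int[pushforward P X']_y sq y)%E.
  rewrite (ge0_integral_pushforward mX' P measurableT msq) //.
  by move=> x _; rewrite lee_fin sqr_ge0.
have -> : (\int[pushforward P X']_y sq y = \int[normal_prob 0 1]_y sq y)%E.
  by apply: eq_measure_integral => A mA _; exact: lawX.
apply: (@le_trans _ _ (\int[leb]_x ((x ^+ 2)%:E * (normal_pdf 0 1 x)%:E))%E).
  apply: (@ge0_integral_density_le _ _ _ leb (normal_prob 0 1) (normal_pdf 0 1) _ _ _ sq) => //.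
  - exact: measurable_normal_pdf.
  - by move=> x; exact: normal_pdf_ge0.
  - by move=> x; rewrite lee_fin sqr_ge0.
set C := 4 * _ / _.
have C0 : 0 <= C by rewrite /C divr_ge0 ?mulr_ge0 // normal_peak_ge0.
have -> : C%:E = (\int[leb]_x (C%:E * (normal_pdf 0 2 x)%:E))%E.
  rewrite ge0_integralZl //.
  - by rewrite integral_normal_pdf mule1.
  - by apply/measurable_EFinP; exact: measurable_normal_pdf.
  - by move=> x _; rewrite lee_fin normal_pdf_ge0.
apply: ge0_le_integral => //.
- by move=> x _; rewrite mule_ge0 // lee_fin ?sqr_ge0 ?normal_pdf_ge0.
- apply: emeasurable_funM => //; apply/measurable_EFinP; exact: measurable_normal_pdf.
- by apply: emeasurable_funM => //; apply/measurable_EFinP; exact: measurable_normal_pdf.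
move=> x _; rewrite -!EFinM lee_fin !normal_pdfE ?oner_eq0 //.
have p2 : normal_peak (2 : R) != 0 by rewrite gt_eqF // normal_peak_gt0.
have -> : C * (normal_peak 2 * normal_fun 0 2 x) = normal_peak 1 * (4 * normal_fun 0 2 x).
  by rewrite /C; field.
rewrite mulrCA; apply: ler_wpM2l; first exact: normal_peak_ge0.
rewrite /normal_fun subr0.
have -> : - x ^+ 2 / (1 ^+ 2 *+ 2) = - x ^+ 2 / (2 ^+ 2 *+ 2) - 3 / 8 * x ^+ 2.
  by field.
rewrite expRD mulrCA [leRHS]mulrC; apply: ler_wpM2l; first exact: expR_ge0.
rewrite expRN ler_pdivrMr ?expR_gt0 //.
(* [x^2 <= 4 * (1 + 3/8 * x^2)], and the parenthesis is below the exponential. *)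
have := expR_ge1Dx (3 / 8 * x ^+ 2); have := sqr_ge0 x; lra.
Qed.

Lemma std_normal_itv_gt0 : (0 < normal_prob (0 : R)%R 1%R [set` `[(2^-1 : R)%R, 1%R]])%E.
Proof.
(* On [1/2, 1] the density is smallest at the right end. *)
pose c : R := normal_pdf 0 1 1.
have c0 : 0 < c.
  by rewrite /c normal_pdfE // mulr_gt0 ?expR_gt0 // normal_peak_gt0.
apply: (@lt_le_trans _ _ (\int[leb]_(x in [set` `[(2^-1 : R)%R, 1%R]]) c%:E)%E).
  rewrite integral_cst //= lebesgue_measure_itv /= lte_fin.
  have -> : ((2^-1 : R) < 1) by lra.
  by rewrite -EFinD -EFinM lte_fin; apply: mulr_gt0 => //; lra.
apply: ge0_le_integral => //.
- by move=> x _; rewrite lee_fin ltW.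
- by apply/measurable_EFinP; apply: measurable_funTS; exact: measurable_normal_pdf.
move=> x /=; rewrite in_itv /= => /andP[x1 x2].
rewrite lee_fin /c !normal_pdfE //; apply: ler_wpM2l; first exact: normal_peak_ge0.
by rewrite /normal_fun ler_expR !subr0 ler_pM2r; [nra|lra].
Qed.

End Gauss.

(** * Measurability and null sets *)

Section Measurability.
Context d (Omega : measurableType d) (R : realType).
Implicit Types (phi : (R -> R) -> R).

(* [X] is the pointwise limit of the countably valued [floor (X * n) / n]. *)
Lemma measurable_fun_lipschitz_param (F : Omega -> R -> R) (X : Omega -> R) (L : R) :
  (forall t, measurable_fun setT (F ^~ t)) ->
  (forall w s t, `|F w s - F w t| <= L * `|s - t|) ->
  measurable_fun setT X -> measurable_fun setT (fun w => F w (X w)).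
Proof.
move=> mF lipF mX.
pose fl n w : int := Num.floor (X w * n.+1%:R).
pose Xn n w : R := (fl n w)%:~R / n.+1%:R.
have Xn_le n w : `|X w - Xn n w| <= n.+1%:R^-1.
  have n0 : 0 < n.+1%:R :> R by [].
  rewrite -(ler_pM2r n0) mulVf ?gt_eqF // -{1}(gtr0_norm n0) -normrM.
  rewrite mulrBl /Xn divfK ?gt_eqF //.
  have /andP[] := floor_itv (X w * n.+1%:R); rewrite -/(fl n w) intrD => h1 h2.
  by rewrite ger0_norm; lra.
apply: (@measurable_fun_cvg _ _ _ _ (fun n w => F w (Xn n w))).
  move=> n _ Y mY; rewrite setTI.
  (* The preimage is cut according to the value of the floor; on each piece the second argument of
     [F] is a constant. *)
  have -> : (fun w => F w (Xn n w)) @^-1` Y =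
      \bigcup_(z : int) ((X @^-1` [set` `[z%:~R / n.+1%:R, (z + 1)%:~R / n.+1%:R[ ])
        `&` (F ^~ (z%:~R / n.+1%:R) @^-1` Y)).
    apply/seteqP; split=> w /=.
      move=> Yw; exists (fl n w) => //; split=> //=.
      by rewrite in_itv /= ler_pdivrMr // ltr_pdivlMr // floor_itv.
    move=> [z _] [/=]; rewrite in_itv /= ler_pdivrMr // ltr_pdivlMr // => zX.
    by rewrite /Xn /fl (floor_def zX).
  apply: countable_bigcupT_measurable => [|z]; first exact: countableP.
  apply: measurableI.
    by rewrite -[X in measurable X]setTI; exact: mX.
  by rewrite -[X in measurable X]setTI; exact: mF.
move=> w _; apply/cvgrPdist_le => e e0.
have e1 : 0 < e / (`|L| + 1) by rewrite divr_gt0 // ltr_wpDl.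
near=> n; apply: le_trans (lipF _ _ _) _.
apply: (@le_trans _ _ ((`|L| + 1) * n.+1%:R^-1)).
  apply: ler_pM => //; first by have := lipF w 1 0; rewrite subr0 normr1 mulr1; apply: le_trans.
  by rewrite (le_trans (ler_norm _)) // lerDl.
rewrite mulrC -ler_pdivlMr ?ltr_wpDl //; apply: ltW.
by near: n; exact: (near_infty_natSinv_lt (PosNum e1)).
Unshelve. all: by end_near. Qed.

(* The random coefficients replace deterministic ones one at a time. *)
Lemma measurable_BL1_fsum phi (X : nat -> Omega -> R) M :
  BL1 phi -> (forall n, measurable_fun setT (X n)) ->
  measurable_fun setT (fun w => phi (fsum (fun n => X n w) M)).
Proof.
move=> [B [L [_ L0 _ _ lipphi]]] mX.
(* The tail [c] stays quantified in the induction: a real parameter is first placed in slot [K] of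
   the tail, then replaced by [X K w] through the Lipschitz dependence on it. *)
pose mix K (c : nat -> R) w n := if (n < K)%N then X n w else c n.
suff mmix K c : measurable_fun setT (fun w => phi (fsum (mix K c w) M)).
  have := mmix M.+1 (fun=> 0); congr measurable_fun; apply/funext => w.
  congr phi; apply/funext => x; apply: eq_big_nat => n /andP[_ nM].
  by rewrite /mix nM.
elim: K c => [|K IH] c.
  have -> : (fun w => phi (fsum (mix 0%N c w) M)) = cst (phi (fsum c M)); last by [].
  by apply/funext => w; congr phi; apply/funext => x; apply: eq_bigr.
pose upd t n : R := if n == K then t else c n.
have -> : (fun w => phi (fsum (mix K.+1 c w) M)) =
    (fun w => phi (fsum (mix K (upd (X K w)) w) M)).
  apply/funext => w; congr phi; apply/funext => x; apply: eq_bigr => n _.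
  by rewrite /mix /upd ltnS; case: ltngtP => // ->.
apply: (measurable_fun_lipschitz_param (F := fun w t => phi (fsum (mix K (upd t) w) M))
  (L := L)) => // w s t.
apply: le_trans (lipphi _ _ (fsum_inH _ _) (fsum_inH _ _)) _.
apply: ler_wpM2l => //; rewrite L2dist_fsum -sqrtr_sqr; apply: ler_wsqrtr.
rewrite (eq_bigr (fun n => if n == K then (s - t) ^+ 2 else 0)).
  rewrite -big_mkcond big_nat1_eq; case: ifP => // _; exact: sqr_ge0.
move=> n _; rewrite /mix /upd; case: ltngtP => // _; by rewrite subrr expr0n.
Qed.

End Measurability.

(** * Integrals of functions that agree off a null set *)

Section NullModification.
Context d (T : measurableType d) (R : realType) (mu : {measure set T -> \bar R}).
Variables (N : set T) (mN : measurable N) (N0 : mu N = 0%E).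

Import HBNNSimple.

(** The integral of a nonnegative function, measurable or not, is a supremum over simple functions
    below it. Setting such a function to 0 on [N] leaves its integral unchanged and puts it below
    [g]. *)
Let ge0_integral_null_le (f g : T -> \bar R) :
  (forall x, 0 <= f x)%E -> (forall x, 0 <= g x)%E ->
  (forall x, ~ N x -> f x = g x) -> (\int[mu]_x f x <= \int[mu]_x g x)%E.
Proof.
move=> f0 g0 fg; rewrite [leLHS]ge0_integralTE // ge_ereal_sup //= => _ [h hf <-].
rewrite -integralT_nnsfun [leRHS]ge0_integralTE //.
apply: ereal_sup_ubound => /=; exists (proj_nnsfun h (measurableC mN)).
  move=> x; rewrite -mrestrict patchE; case: ifPn => [|_]; last exact: g0.
  by rewrite inE /= => Nx; rewrite -fg.
rewrite -integralT_nnsfun; apply: ae_eq_integral => //.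
- exact/measurable_EFinP/measurable_funTS.
- exact/measurable_EFinP/measurable_funTS.
exists N; split => // x hx; apply: contrapT => Nx; apply: hx => _.
by rewrite -(mrestrict h (measurableC mN)) patchE mem_set.
Qed.

(* No measurability is assumed: off the almost sure event of [series_version] the
   value [phi (Y w)] is arbitrary. *)
Lemma eq_integral_null (f g : T -> \bar R) : (forall x, ~ N x -> f x = g x) ->
  (\int[mu]_x f x = \int[mu]_x g x)%E.
Proof.
have ge0_eq (u v : T -> \bar R) : (forall x, 0 <= u x)%E -> (forall x, 0 <= v x)%E ->
    (forall x, ~ N x -> u x = v x) -> (\int[mu]_x u x = \int[mu]_x v x)%E.
  move=> u0 v0 uv; apply/eqP; rewrite eq_le !ge0_integral_null_le // => x Nx.
  by rewrite uv.
move=> fg; rewrite integralE [RHS]integralE; congr (_ - _)%E; apply: ge0_eq => // x Nx.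
- by rewrite !funeposE fg.
- by rewrite !funenegE fg.
Qed.

End NullModification.

(** * Expectations of bounded Lipschitz functionals *)

Section Expectation.
Context (R : realType) d (Omega : measurableType d) (P : probability Omega R).
Variable (xi : nat -> Omega -> R).
Hypothesis mxi : forall n, measurable_fun setT (xi n).
Implicit Types (phi : (R -> R) -> R) (s : nat -> R) (Y Z : Omega -> R -> R).

Lemma expectE phi Y : expect P phi Y = \int[P]_w phi (Y w).
Proof. by []. Qed.

Lemma psumE s M w : psum s xi M w = fsum (fun n => Num.sqrt (s n) * xi n w) M.
Proof. by []. Qed.

Lemma BL1_norm_le1 phi f : BL1 phi -> inH f -> `|phi f| <= 1.
Proof. by move=> [B [L [B0 L0 BL phiB _]]] /phiB; lra. Qed.

Lemma measurable_BL1_psum phi s M :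
  BL1 phi -> measurable_fun setT (fun w => phi (psum s xi M w)).
Proof.
move=> bphi.
apply: (measurable_BL1_fsum (X := fun n w => Num.sqrt (s n) * xi n w)) => // n.
exact: measurable_funM.
Qed.

Lemma integrable_bounded (f : Omega -> R) (B : R) : measurable_fun setT f ->
  (forall w, `|f w| <= B) -> P.-integrable setT (EFin \o f).
Proof.
move=> mf fB; apply: measurable_bounded_integrable => //.
  by rewrite -ge0_fin_numE // fin_num_measure.
by exists B; split; [exact: num_real|move=> C /ltW BC w _; exact: le_trans (fB w) BC].
Qed.

Lemma integrable_BL1_psum phi s M :
  BL1 phi -> P.-integrable setT (EFin \o (fun w => phi (psum s xi M w))).
Proof.
move=> bphi; apply: (@integrable_bounded _ 1); first exact: measurable_BL1_psum.
by move=> w; apply: BL1_norm_le1 => //; exact: fsum_inH.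
Qed.

(** Dominated convergence with the constant 1. This is the passage from finite sums, where
    measurability is available, to the series itself. *)
Lemma expect_psum_cvg phi s Y : BL1 phi -> series_version P xi s Y ->
  (fun M => expect P phi (psum s xi M)) @ \oo --> expect P phi Y.
Proof.
move=> bphi [N [mN N0 badN]].
have good w : ~ N w -> inH (Y w) /\
    (fun M => L2dist (psum s xi M w) (Y w)) @ \oo --> (0 : R).
  by move=> Nw; apply: contrapT => /badN.
pose f M w := phi (psum s xi M w).
have f1 M w : `|f M w| <= 1 by apply: BL1_norm_le1 => //; exact: fsum_inH.
have f_cvg w : ~ N w -> f ^~ w @ \oo --> phi (Y w).
  move=> /good[HY dY]; have [B [L [_ L0 _ _ lipphi]]] := bphi.
  apply/cvgrPdist_le => e e0; have e1 : 0 < e / (L + 1) by rewrite divr_gt0 // ltr_wpDl.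
  move/cvgrPdist_le: dY => /(_ _ e1); apply: filterS => M; rewrite sub0r normrN.
  move=> dM; rewrite distrC; apply: le_trans (lipphi _ _ (fsum_inH _ _) HY) _.
  rewrite ger0_norm ?L2dist_ge0 // ler_pdivlMr ?ltr_wpDl // in dM.
  have := L2dist_ge0 (psum s xi M w) (Y w); rewrite -/(fsum _ _) in dM *; lra.
(* Clearing the null set makes [g] an everywhere pointwise limit of measurable functions, hence
   measurable; [phi (Y w)] itself may fail to be. *)
pose g w := if w \in N then 0 else phi (Y w).
pose fN M w := f M w * \1_(~` N) w.
have gcvg w : fN ^~ w @ \oo --> g w.
  rewrite /fN /g indicE in_setC; case: ifPn => [_|/negP Nw] /=.
    by under eq_fun do rewrite mulr0; exact: cvg_cst.
  under eq_fun do rewrite mulr1; apply: f_cvg => Nw'; apply: Nw.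
  by rewrite inE.
have mg : measurable_fun setT g.
  apply: (@measurable_fun_cvg _ _ _ _ fN) => [M|w _]; last exact: gcvg.
  apply: measurable_funM; first exact: measurable_BL1_psum.
  exact/measurable_indic/measurableC.
have := @dominated_convergence _ _ _ P setT measurableT (fun M => EFin \o f M)
  (EFin \o g) (fun=> 1%E).
case.
- by move=> M; apply/measurable_EFinP; exact: measurable_BL1_psum.
- exact/measurable_EFinP.
- exists N; split => // w /= bad; apply: contrapT => Nw; apply: bad => _.
  apply: cvg_EFin; first by apply: nearW.
  rewrite /g ifN; last by apply/negP; rewrite inE.
  exact: f_cvg.
- exact: (finite_measure_integrable_cst P 1 measurableT).
- by apply: aeW => w M _ /=; rewrite lee_fin.
move=> ig _ icvg.
have -> : expect P phi Y = fine (\int[P]_w (g w)%:E).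
  congr fine; apply: (eq_integral_null mN N0) => w Nw.
  by rewrite /g ifN //; apply/negP; rewrite inE.
apply: fine_cvg; rewrite fineK //.
exact: integrable_fin_num.
Qed.

(** The real-valued [sup] is an upper bound only for a set that is bounded above; the two hypotheses
    supply the bound 2. *)
Lemma dBL_ub Y Z : (forall phi, BL1 phi -> `|expect P phi Y| <= 1) ->
  (forall phi, BL1 phi -> `|expect P phi Z| <= 1) ->
  forall phi, BL1 phi -> `|expect P phi Y - expect P phi Z| <= dBL P Y Z.
Proof.
move=> Y1 Z1 phi bphi; apply: ub_le_sup; last by exists phi.
exists 2 => _ [psi bpsi <-]; apply: le_trans (ler_normB _ _) _.
by have := Y1 _ bpsi; have := Z1 _ bpsi; lra.
Qed.

(** Shows that the set under the supremum is nonempty, as bounding a real [sup] from above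
    requires. *)
Lemma BL1_cst0 : BL1 (fun _ : R -> R => 0 : R).
Proof.
exists 0, 0; split; rewrite ?addr0 //.
- by move=> f _; rewrite normr0.
- by move=> f g _ _; rewrite subrr normr0 mul0r.
Qed.

Lemma dBL_le Y Z b :
  (forall phi, BL1 phi -> `|expect P phi Y - expect P phi Z| <= b) -> dBL P Y Z <= b.
Proof.
move=> le_b; apply: ge_sup.
  by exists `|expect P (fun=> 0) Y - expect P (fun=> 0) Z|, (fun=> 0) => //; exact: BL1_cst0.
by move=> _ [phi bphi <-]; exact: le_b.
Qed.

Lemma norm_expect_psum_le1 phi s M : BL1 phi -> `|expect P phi (psum s xi M)| <= 1.
Proof.
move=> bphi; apply: le_trans (le_normr_Rintegral measurableT (integrable_BL1_psum s M bphi)) _.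
rewrite -[leRHS](_ : \int[P]_w (1 : R) = 1); last first.
  by rewrite Rintegral_cst // mul1r; exact: (congr1 fine (probability_setT P)).
apply: le_Rintegral => //.
- exact/integrable_norm/integrable_BL1_psum.
- exact: (finite_measure_integrable_cst P 1 measurableT).
- by move=> w _; apply: BL1_norm_le1 => //; exact: fsum_inH.
Qed.

(** Inherited from the partial sums, since [phi (Y w)] is not known to be measurable. *)
Lemma norm_expect_le1 phi s Y : BL1 phi -> series_version P xi s Y ->
  `|expect P phi Y| <= 1.
Proof.
move=> bphi /(expect_psum_cvg bphi) /cvg_norm cY.
rewrite -(cvg_lim _ cY) //; apply: limr_le; first by apply/cvg_ex; eexists; exact: cY.
by apply: nearW => M; exact: norm_expect_psum_le1.
Qed.

Lemma integrable_bigsum (I : Type) (r : seq I) (f : I -> Omega -> R) :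
  (forall i, P.-integrable setT (EFin \o f i)) ->
  P.-integrable setT (EFin \o (fun w => \sum_(i <- r) f i w)).
Proof.
move=> fi; rewrite (_ : EFin \o _ = fun w => (\sum_(i <- r) (f i w)%:E)%E).
  by apply: integrable_sum => // i _; exact: fi.
by apply/funext => w /=; rewrite sumEFin.
Qed.

Lemma Rintegral_bigsum (I : Type) (r : seq I) (f : I -> Omega -> R) :
  (forall i, P.-integrable setT (EFin \o f i)) ->
  \int[P]_w (\sum_(i <- r) f i w) = \sum_(i <- r) \int[P]_w f i w.
Proof.
move=> fi; elim: r => [|i r IH].
  rewrite big_nil (@eq_Rintegral _ _ _ P setT (fun=> 0)).
    by rewrite Rintegral_cst // mul0r.
  by move=> w _; rewrite big_nil.
rewrite big_cons -IH -RintegralD //; last exact: integrable_bigsum.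
by apply: eq_Rintegral => w _; rewrite big_cons.
Qed.

Lemma integrableZ a (f : Omega -> R) : P.-integrable setT (EFin \o f) ->
  P.-integrable setT (EFin \o (fun w => a * f w)).
Proof.
move=> fi; rewrite (_ : EFin \o _ = (fun w => a%:E * (f w)%:E)%E) //.
exact: integrableZl.
Qed.

End Expectation.

(** * Two-sided bounds for the bounded Lipschitz distance *)

Section Bounds.
Context (R : realType) d (Omega : measurableType d) (P : probability Omega R).
Variable (xi : nat -> Omega -> R).
Hypothesis iid_xi : iid_std_normal P xi.

Let mxi n : measurable_fun setT (xi n) := iid_xi.1 n.

(** A crude bound on the second moment, whose exact value is 1; it enters only the constants, not
    the rates. *)
Definition sqr_bound : R := 4 * normal_peak 1 / normal_peak 2.

Lemma sqr_bound_ge0 : 0 <= sqr_bound.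
Proof. by rewrite divr_ge0 ?mulr_ge0 // normal_peak_ge0. Qed.

Lemma xi_sqr n : P.-integrable setT (EFin \o (fun w => xi n w ^+ 2)) /\
  \int[P]_w (xi n w ^+ 2) <= sqr_bound.
Proof.
have le_K := std_normal_sqr_le (mxi n) (iid_xi.2.1 n).
have fin : (\int[P]_w (xi n w ^+ 2)%:E < +oo)%E by rewrite (le_lt_trans le_K) ?ltry.
split.
  apply/integrableP; split.
    by apply/measurable_EFinP; exact: measurable_funX.
  rewrite (@eq_integral _ _ _ P setT (fun w => (xi n w ^+ 2)%:E)) // => w _ /=.
  by rewrite ger0_norm // sqr_ge0.
rewrite -lee_fin /Rintegral fineK // ge0_fin_numE //.
by apply: integral_ge0 => w _; rewrite lee_fin sqr_ge0.
Qed.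

(** The expected distance is that of [sqrt S], while only the mean of [S] is controlled. The
    pointwise bound [sqrt S <= S / e + e] reduces one to the other, and [e = sqrt B] balances the
    two terms. As [B] is the same for all [M], the estimate survives the limit. *)
Lemma dBL_upper s s' Y Z (B : R) : 0 < B ->
  series_version P xi s Y -> series_version P xi s' Z ->
  (forall M, \sum_(1 <= n < M.+1) (Num.sqrt (s n) - Num.sqrt (s' n)) ^+ 2 <= B) ->
  dBL P Y Z <= (sqr_bound + 1) * Num.sqrt B.
Proof.
move=> B0 vY vZ sB; apply: dBL_le => phi bphi.
have cYZ : (fun M => `|expect P phi (psum s xi M) - expect P phi (psum s' xi M)|) @ \oo
    --> `|expect P phi Y - expect P phi Z|.
  by apply: cvg_norm; apply: cvgB; exact: expect_psum_cvg.
rewrite -(cvg_lim _ cYZ) //; apply: limr_le.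
  by apply/cvg_ex; eexists; exact: cYZ.
apply: nearW => M /=.
have iphi t := integrable_BL1_psum P mxi t M bphi.
pose a n := Num.sqrt (s n) - Num.sqrt (s' n).
set e := Num.sqrt B; have e0 : 0 < e by rewrite sqrtr_gt0.
have eB : e ^+ 2 = B by rewrite sqr_sqrtr // ltW.
pose S w : R := \sum_(1 <= n < M.+1) a n ^+ 2 * xi n w ^+ 2.
have iS : P.-integrable setT (EFin \o S).
  by apply: integrable_bigsum => n; apply: integrableZ; exact: (xi_sqr n).1.
have IS : \int[P]_w S w <= sqr_bound * B.
  rewrite Rintegral_bigsum; last first.
    by move=> n; apply: integrableZ; exact: (xi_sqr n).1.
  apply: (@le_trans _ _ (\sum_(1 <= n < M.+1) sqr_bound * a n ^+ 2)).
    apply: ler_sum => n _; rewrite RintegralZl //; last exact: (xi_sqr n).1.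
    by rewrite mulrC; apply: ler_wpM2r; [exact: sqr_ge0|exact: (xi_sqr n).2].
  by rewrite -big_distrr /=; apply: ler_wpM2l; [exact: sqr_bound_ge0|exact: sB].
rewrite !expectE -RintegralB //.
apply: le_trans (le_normr_Rintegral measurableT _) _.
  rewrite (_ : EFin \o _ = (EFin \o (fun w => phi (psum s xi M w))) \-
     (EFin \o (fun w => phi (psum s' xi M w))))%E //.
  exact: integrableB.
apply: (@le_trans _ _ (\int[P]_w (e^-1 * S w + e))).
  apply: le_Rintegral => //.
  - apply: (@integrable_norm _ _ _ _ _ (fun w => phi (psum s xi M w) - phi (psum s' xi M w))).
    rewrite (_ : EFin \o _ = (EFin \o (fun w => phi (psum s xi M w))) \-
      (EFin \o (fun w => phi (psum s' xi M w))))%E //.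
    exact: integrableB.
  - rewrite (_ : EFin \o _ = (EFin \o (fun w => (e^-1 * S w)%R)) \+ (EFin \o cst e))%E //.
    apply: integrableD => //; first exact: integrableZ.
    exact: finite_measure_integrable_cst.
  - move=> w _; have [C [L [C0 L0 CL _ lipphi]]] := bphi.
    apply: le_trans (lipphi _ _ (fsum_inH _ _) (fsum_inH _ _)) _.
    rewrite L2dist_fsum.
    have -> : \sum_(1 <= n < M.+1) (Num.sqrt (s n) * xi n w - Num.sqrt (s' n) * xi n w) ^+ 2 = S w.
      by apply: eq_bigr => n _; rewrite -mulrBl exprMn.
    have S0 : 0 <= S w by apply: sumr_ge0 => n _; rewrite mulr_ge0 // sqr_ge0.
    have := sqrtr_ge0 (S w); have := sqr_sqrtr S0; move: (Num.sqrt (S w)) => q qS q0.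
    rewrite -qS (_ : e^-1 * _ + e = (q ^+ 2 + e ^+ 2) / e); last by field; rewrite gt_eqF.
    rewrite ler_pdivlMr //; have qe : 0 <= q * e by rewrite mulr_ge0 // ltW.
    (* AM-GM: [q <= (q ^+ 2 + e ^+ 2) / e] *)
    have := sqr_ge0 (q - e); have := sqr_ge0 q; have := sqr_ge0 e.
    have : L * q * e <= q * e by rewrite -mulrA ler_piMl //; lra.
    nra.
rewrite RintegralD //; last 2 first.
- exact: integrableZ.
- exact: finite_measure_integrable_cst.
rewrite RintegralZl // Rintegral_cst // (_ : fine _ = 1); last first.
  exact: (congr1 fine (probability_setT P)).
rewrite mulr1 mulrDl mul1r lerD2r mulrC ler_pdivrMr //.
by rewrite -mulrA -expr2 eB.
Qed.

Definition prob_half_one : R := fine (normal_prob (0 : R)%R 1%R [set` `[(2^-1 : R)%R, 1%R]]).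

Lemma prob_half_one_gt0 : 0 < prob_half_one.
Proof.
apply: fine_gt0; apply/andP; split; first exact: std_normal_itv_gt0.
rewrite (@le_lt_trans _ _ 1%E) ?ltry //.
exact: (@probability_le1 _ _ _ (normal_prob 0 1)).
Qed.

(** The cap [1 / sqrt m] bounds the sum of [m] terms by [sqrt m], which the prefactor cancels. It is
    also at least the standard deviations of the blocks in use, so it does not bite where
    [|xi n| <= 1]. *)
Definition block_fun (a m : nat) (f : R -> R) : R :=
  2^-1 * ((Num.sqrt m%:R)^-1 *
    \sum_(a <= n < a + m) Num.min `|ip f (efun n)| (Num.sqrt m%:R)^-1).

Lemma norm_min_le (p r t b : R) : p - r <= t -> r - p <= t -> 0 <= t ->
  `|Num.min p b - Num.min r b| <= t.
Proof.
move=> pr rp t0; rewrite ler_norml.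
by case: (leP p b) => ?; case: (leP r b) => ?; apply/andP; split; lra.
Qed.

Lemma block_fun_BL1 a m : (0 < a)%N -> (0 < m)%N -> BL1 (block_fun a m).
Proof.
move=> a0 m0; set q : R := (Num.sqrt m%:R)^-1.
have q0 : 0 <= q by rewrite invr_ge0 sqrtr_ge0.
have qm : q ^+ 2 * m%:R = 1.
  by rewrite exprVn sqr_sqrtr ?ler0n // mulVf // pnatr_eq0 -lt0n.
(* The factor 1/2 in [block_fun] shares the budget [M + L <= 1] equally between the bound and the
   Lipschitz constant. *)
exists (2^-1), (2^-1); split => //; first by lra.
- move=> f _; rewrite /block_fun -/q ger0_norm; last first.
    by rewrite !mulr_ge0 ?sumr_ge0 // => n _; rewrite le_min normr_ge0.
  rewrite -[leRHS]mulr1; apply: ler_wpM2l; first by [].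
  rewrite -qm expr2 -mulrA; apply: ler_wpM2l => //.
  apply: (@le_trans _ _ (\sum_(a <= n < a + m) q)).
    by apply: ler_sum => n _; rewrite ge_min lexx orbT.
  by rewrite sumr_const_nat addKn mulr_natr.
- move=> f g Hf Hg; pose u n := ip f (efun n) - ip g (efun n).
  (* The signs turn the sum of absolute values into a single inner product with [fsum c], which has
     norm at most 1 because [q^2 * m = 1]. *)
  pose c n := if (a <= n)%N then q * Num.sg (u n) else 0.
  apply: (@le_trans _ _ (2^-1 * (ip f (fsum c (a + m).-1) - ip g (fsum c (a + m).-1)))).
    rewrite /block_fun -/q -mulrBr -mulrBr normrM ger0_norm ?invr_ge0 //.
    apply: ler_wpM2l; first by rewrite invr_ge0.
    rewrite !(ipC _ (fsum _ _)) !ip_fsuml // -sumrB.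
    rewrite prednK ?addn_gt0 ?a0 // -sumrB.
    rewrite (@big_cat_nat _ _ _ a 1 (a + m)) ?leq_addr //=.
    rewrite [X in _ <= X + _]big_nat [X in _ <= X + _]big1 ?add0r; last first.
      by move=> n /andP[_ na]; rewrite /c leqNgt na /= !mul0r subrr.
    rewrite normrM ger0_norm //.
    apply: le_trans (ler_wpM2l q0 (ler_norm_sum _ _ _)) _.
    rewrite big_distrr /=; apply: ler_sum_nat => n /andP[an _].
    rewrite /c an !(ipC (efun n)) -mulrBr -/(u n) -mulrA -normrEsg.
    apply: ler_wpM2l => //; apply: norm_min_le => //; first exact: lerB_dist.
    by rewrite distrC; exact: lerB_dist.
  apply: ler_wpM2l; first by rewrite invr_ge0.
  apply: ip_le_L2 => //; first exact: fsum_inH.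
  rewrite ip_fsum prednK ?addn_gt0 ?a0 //.
  rewrite (@big_cat_nat _ _ _ a 1 (a + m)) ?leq_addr //=.
  rewrite big_nat big1 ?add0r; last first.
    by move=> n /andP[_ na]; rewrite /c leqNgt na /= expr0n.
  apply: (@le_trans _ _ (\sum_(a <= n < a + m) q ^+ 2)).
    apply: ler_sum_nat => n /andP[an _]; rewrite /c an exprMn sqr_sg.
    by rewrite -[leRHS]mulr1; apply: ler_wpM2l; [exact: sqr_ge0|case: (_ != 0)].
  by rewrite sumr_const_nat addKn -[leLHS]mulr_natr qm.
Qed.

Lemma block_fun_psum a m s M w : (0 < a)%N -> (a + m <= M.+1)%N ->
  block_fun a m (psum s xi M w) = 2^-1 * ((Num.sqrt m%:R)^-1 *
    \sum_(a <= n < a + m) Num.min (Num.sqrt (s n) * `|xi n w|) (Num.sqrt m%:R)^-1).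
Proof.
move=> a0 aM; rewrite /block_fun; congr (_ * (_ * _)).
apply: eq_big_nat => n /andP[an nm].
rewrite psumE ip_fsum_efun ?(leq_trans a0) // -ltnS (leq_trans nm) //.
by rewrite normrM ger0_norm ?sqrtr_ge0.
Qed.

(** On the block [s'] lies below [s], so by monotonicity of the capped terms no mode ever
    contributes negatively. When [xi n] is in [1/2, 1] the cap is inactive and the mode gains at
    least [delta / 2]. Summing the [m] expected gains with the prefactor [1 / (2 sqrt m)] gives the
    stated constant. *)
Lemma dBL_lower (a m : nat) s s' Y Z (delta : R) : (0 < a)%N -> (0 < m)%N -> 0 <= delta ->
  series_version P xi s Y -> series_version P xi s' Z ->
  (forall n, (a <= n < a + m)%N -> Num.sqrt (s n) <= (Num.sqrt m%:R)^-1) ->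
  (forall n, (a <= n < a + m)%N -> Num.sqrt (s' n) + delta <= Num.sqrt (s n)) ->
  Num.sqrt m%:R * delta * prob_half_one / 4 <= dBL P Y Z.
Proof.
move=> a0 m0 d0 vY vZ s_le gap; set q : R := (Num.sqrt m%:R)^-1.
have q0 : 0 <= q by rewrite invr_ge0 sqrtr_ge0.
have bphi := block_fun_BL1 a0 m0; set phi := block_fun a m in bphi.
apply: le_trans (dBL_ub _ _ bphi); last 2 first.
- by move=> psi bpsi; exact: norm_expect_le1 vY.
- by move=> psi bpsi; exact: norm_expect_le1 vZ.
apply: le_trans (ler_norm _).
have cYZ : (fun M => expect P phi (psum s xi M) - expect P phi (psum s' xi M)) @ \oo
    --> expect P phi Y - expect P phi Z.
  by apply: cvgB; exact: expect_psum_cvg.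
rewrite -(cvg_lim _ cYZ) //; apply: limr_ge.
  by apply/cvg_ex; eexists; exact: cYZ.
(* From here on the partial sums contain the whole block. *)
exists (a + m)%N => // M /= aM; rewrite !expectE.
have iphi t := integrable_BL1_psum P mxi t M bphi.
rewrite -RintegralB //.
pose A : set R := [set` `[(2^-1 : R)%R, 1%R]].
have mA n : measurable (xi n @^-1` A).
  by rewrite -[X in measurable X]setTI; apply: mxi; [exact: measurableT|exact: measurable_itv].
pose ind n w : R := delta / 2 * \1_(xi n @^-1` A) w.
have i1 n : P.-integrable setT (EFin \o (\1_(xi n @^-1` A) : Omega -> R)).
  exact: integrable_indic.
have iind n : P.-integrable setT (EFin \o ind n) by exact: integrableZ.
have -> : Num.sqrt m%:R * delta * prob_half_one / 4 =
    \int[P]_w (2^-1 * q * \sum_(a <= n < a + m) ind n w).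
  rewrite RintegralZl //; last exact: integrable_bigsum.
  rewrite Rintegral_bigsum // (eq_bigr (fun=> delta / 2 * prob_half_one)); last first.
    move=> n _; rewrite RintegralZl //; congr (_ * _).
    rewrite /Rintegral integral_indic // setIT.
    exact: (congr1 fine (iid_xi.2.1 n A (measurable_itv _))).
  rewrite sumr_const_nat addKn -[_ * prob_half_one *+ m]mulr_natr /q.
  have m1 : 0 < m%:R :> R by rewrite ltr0n.
  have qq : Num.sqrt m%:R ^+ 2 = m%:R :> R by rewrite sqr_sqrtr // ltW.
  have q1 : Num.sqrt m%:R != 0 :> R by rewrite gt_eqF // sqrtr_gt0.
  by move: qq q1; move: (Num.sqrt _) => S <- S0; field.
apply: le_Rintegral => //.
- by apply: integrableZ; exact: integrable_bigsum.
- rewrite (_ : EFin \o _ = (EFin \o (fun w => phi (psum s xi M w))) \-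
      (EFin \o (fun w => phi (psum s' xi M w))))%E //.
  exact: integrableB.
move=> w _; rewrite /phi !block_fun_psum ?leqW //.
rewrite -/q -mulrBr -mulrBr -sumrB -mulrA; apply: ler_wpM2l; first by rewrite invr_ge0.
apply: ler_wpM2l => //; apply: ler_sum_nat => n nm.
have := gap _ nm; have := s_le _ nm; rewrite -/q.
have := sqrtr_ge0 (s' n); move: (Num.sqrt (s n)) (Num.sqrt (s' n)) => u v v0 uq uv.
have x0 := normr_ge0 (xi n w); have x1 := ler_norm (xi n w).
rewrite /ind indicE; case: (boolP (w \in xi n @^-1` A)) => [|_] /=.
  rewrite inE /A /= in_itv /= mulr1 => /andP[xl xu].
  have xg : 0 <= xi n w by lra.
  have u0 : 0 <= u by lra.
  have ux : u * xi n w <= u by rewrite ler_piMr.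
  have vx : v * xi n w <= u * xi n w by apply: ler_wpM2r => //; lra.
  rewrite (ger0_norm xg).
  rewrite !min_l; [nra|nra|nra].
rewrite mulr0 subr_ge0 le_min !ge_min.
rewrite lexx orbT andbT; apply/orP; left; apply: ler_wpM2r => //; lra.
Qed.

End Bounds.

(** * Eigenvalues and covariances *)

Section Eigenvalues.
Context (R : realType).
Implicit Types (T dt : R) (n k N : nat).
Local Notation lam := (@lam R).

(** Replaces the integral test: [f] acts as a discrete primitive and gives bounds on the partial
    sums that are uniform in [M]. *)
Lemma sum_le_telescope (u f : nat -> R) M :
  (forall n, u n.+1 <= f n - f n.+1) -> \sum_(1 <= n < M.+1) u n <= f 0%N - f M.
Proof.
move=> uf; elim: M => [|M IH]; first by rewrite big_geq // subrr.
by rewrite big_nat_recr //=; have := uf M; lra.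
Qed.

Lemma pi2_ge4 : 4 <= pi ^+ 2 :> R.
Proof. by have := pi_ge2 R; nra. Qed.

Lemma lam_ge n : 4 * n%:R ^+ 2 <= lam n.
Proof. by apply: ler_wpM2r; [exact: sqr_ge0|exact: pi2_ge4]. Qed.

Lemma lam_gt0 n : (0 < n)%N -> 0 < lam n.
Proof. by move=> n0; rewrite mulr_gt0 // exprn_gt0 ?pi_gt0 // ltr0n. Qed.

Lemma lam_ge1 n : (0 < n)%N -> 1 <= lam n.
Proof.
move=> n0; have := lam_ge n; have : 1 <= n%:R :> R by rewrite ler1n.
by nra.
Qed.

Lemma lam_le m n : (m <= n)%N -> lam m <= lam n.
Proof.
move=> mn; apply: ler_wpM2l; first by rewrite sqr_ge0.
by rewrite lerXn2r ?nnegrE ?ler_nat.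
Qed.

Lemma qT_le T n : (0 < n)%N -> qT T n <= (2 * lam n)^-1.
Proof.
move=> n0; have l0 := lam_gt0 n0; have l2 : 0 < 2 * lam n by rewrite mulr_gt0.
by rewrite ler_pdivrMr // mulVf ?gt_eqF // lerBlDr lerDl expR_ge0.
Qed.

Lemma qT_ge T n (kappa : R) : (0 < n)%N -> expR (- (2 * lam n * T)) <= 1 - kappa ->
  kappa / (2 * lam n) <= qT T n.
Proof.
move=> n0 Ek; have l0 := lam_gt0 n0.
by apply: ler_wpM2r; [rewrite invr_ge0 mulr_ge0 // ltW|lra].
Qed.

Lemma inv_lam_le n : (0 < n)%N -> (2 * lam n)^-1 <= (n%:R ^+ 2)^-1.
Proof.
move=> n0; have l0 := lam_gt0 n0; have n0' : 0 < n%:R :> R by rewrite ltr0n.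
have n2 := exprn_gt0 2 n0'; have l2 : 0 < 2 * lam n by rewrite mulr_gt0.
by rewrite lef_pV2 ?posrE //; have := lam_ge n; lra.
Qed.

Lemma sqrt_qT_le T n m : (0 < m)%N -> (m <= n)%N ->
  Num.sqrt (qT T n) <= (Num.sqrt m%:R)^-1.
Proof.
move=> m0 mn; have n0 := leq_trans m0 mn.
rewrite -sqrtrV ?ler0n //; apply: ler_wsqrtr.
apply: le_trans (qT_le _ n0) (le_trans (inv_lam_le n0) _).
have m1 : 1 <= m%:R :> R by rewrite ler1n.
have mnR : m%:R <= n%:R :> R by rewrite ler_nat.
by rewrite lef_pV2 ?posrE ?exprn_gt0; nra.
Qed.

Lemma sqr_sqrtB_le (x y : R) : 0 <= y -> y <= x ->
  (Num.sqrt x - Num.sqrt y) ^+ 2 <= x - y.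
Proof.
move=> y0 yx; have x0 := le_trans y0 yx.
have := ler_wsqrtr yx; have := sqrtr_ge0 y.
have := sqr_sqrtr x0; have := sqr_sqrtr y0.
move: (Num.sqrt x) (Num.sqrt y) => u v vy ux v0 vu.
have : v * v <= v * u by apply: ler_wpM2l.
by rewrite -vy -ux; lra.
Qed.

Lemma sum_inv_sqr_le N M : (0 < N)%N ->
  \sum_(1 <= n < M.+1) (if (n <= N)%N then 0 else (n%:R ^+ 2)^-1) <= N%:R^-1 :> R.
Proof.
(* Constant up to [N], where the summand vanishes, and [1 / n] beyond, where
   [1 / (n+1)^2 <= 1 / n - 1 / (n+1)]. *)
move=> N0; pose f n : R := (maxn n N)%:R^-1.
have f0 n : 0 <= f n by rewrite invr_ge0 ler0n.
apply: (@le_trans _ _ (f 0%N - f M)); last first.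
  by rewrite {1}/f max0n lerBlDr lerDl f0.
apply: sum_le_telescope => n; rewrite /f;
  case: (boolP (n.+1 <= N)%N) => nN; last rewrite -ltnNge ltnS in nN.
  by rewrite (maxn_idPr (ltnW nN)) (maxn_idPr nN) subrr.
rewrite (maxn_idPl (leqW nN)) (maxn_idPl nN).
have n0 : 0 < n%:R :> R by rewrite ltr0n (leq_trans N0).
rewrite -natr1; set x : R := n%:R in n0 *.
rewrite -subr_ge0 (_ : _ - _ = (x * (x + 1) ^+ 2)^-1).
  by rewrite invr_ge0 mulr_ge0 ?sqr_ge0 // ltW.
by field; apply/andP; split; lra.
Qed.

(* With [rho = 1 / (1 + dt * l)] this is [rho ^+ (2 * k)], the discrete counterpart of
   [expR (- (2 * l * T))]. *)
Definition rhoG dt l k : R := ((1 + dt * l) ^+ (2 * k))^-1.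

Lemma vEulerE dt k n : 0 < dt -> (0 < n)%N ->
  vEuler dt k n = (1 - rhoG dt (lam n) k) / (2 * lam n + dt * lam n ^+ 2).
Proof.
move=> dt0 n0; have l0 := lam_gt0 n0; rewrite /vEuler.
move: (lam n) l0 => l l0.
set x := dt * l; have x0 : 0 < x by rewrite mulr_gt0.
(* Geometric sum of ratio [(1 + x)^-2], cleared of its denominator [(1 + x)^2 - 1]. *)
have geo : (2 * x + x ^+ 2) * \sum_(i < k) ((1 + x)^-1) ^+ (2 * (k - i)) = 1 - rhoG dt l k.
  rewrite /rhoG -/x; elim: k => [|k IH]; first by rewrite big_ord0 mulr0 muln0 expr0 invr1 subrr.
  rewrite big_ord_recl subn0 mulrDr.
  rewrite (eq_bigr (fun i : 'I_k => ((1 + x)^-1) ^+ (2 * (k - i)))); last first.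
    by move=> i _; rewrite lift0 subSS.
  rewrite IH exprVn mulnS addnC exprD.
  have : (1 + x) ^+ (2 * k) != 0 by rewrite expf_neq0 // gt_eqF // addr_gt0.
  move: (_ ^+ (2 * k)) => y y0; field; rewrite y0 /= gt_eqF //; lra.
rewrite -geo; set s := \sum_(i < k) _.
have d0 : 0 < dt * l ^+ 2 by rewrite mulr_gt0 // exprn_gt0.
by rewrite /x; field; rewrite gt_eqF //; lra.
Qed.

Lemma rhoG_ge_exp T dt l k : 0 < dt -> 0 < l -> k%:R * dt <= T ->
  expR (- (2 * l * T)) <= rhoG dt l k.
Proof.
move=> dt0 l0 kT; have x0 : 0 < dt * l by rewrite mulr_gt0.
have x1 : 0 < 1 + dt * l by rewrite addr_gt0.
rewrite /rhoG expRN lef_pV2 ?posrE ?expR_gt0 ?exprn_gt0 //.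
apply: (@le_trans _ _ (expR (dt * l) ^+ (2 * k))).
  by rewrite lerXn2r ?nnegrE ?expR_ge0 ?expR_ge1Dx // ltW.
rewrite -expRM_natl ler_expR natrM.
have : l * (k%:R * dt) <= l * T by rewrite ler_pM2l.
by lra.
Qed.

(** Bernoulli gives [(1 + dt * l)^k >= k * dt * l], and [k * dt >= T / 2]. The decay in [l^(-2)]
    leaves a summable bound after multiplication by a factor growing like [l]. *)
Lemma rhoG_le T dt l k : 0 < dt -> 0 < l -> dt <= T / 2 -> T <= (k%:R + 1) * dt ->
  rhoG dt l k <= 4 / (T * l) ^+ 2.
Proof.
move=> dt0 l0 dtT Tk; have T0 : 0 < T by lra.
have Tl0 : 0 < T * l by rewrite mulr_gt0.
have x0 : 0 < dt * l by rewrite mulr_gt0.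
have bern : 1 + k%:R * (dt * l) <= (1 + dt * l) ^+ k.
  elim: (k) => [|j IH]; first by rewrite mul0r addr0 expr0.
  rewrite exprS -natr1; have x1 : 0 <= 1 + dt * l by lra.
  apply: le_trans (ler_wpM2l x1 IH).
  have : 0 <= j%:R * (dt * l) ^+ 2 by rewrite mulr_ge0 ?sqr_ge0.
  by move: (dt * l) (j%:R) => x y; nra.
have kx : T * l / 2 <= k%:R * (dt * l).
  by have : l * (T / 2) <= l * (k%:R * dt); [rewrite ler_pM2l //; lra|lra].
rewrite /rhoG -[leRHS]invrK lef_pV2 ?posrE ?invr_gt0 ?divr_gt0 ?exprn_gt0 //; last by lra.
rewrite invf_div mulnC exprM.
have : T * l / 2 <= (1 + dt * l) ^+ k by lra.
have : 0 <= T * l / 2 by rewrite divr_ge0 // ltW.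
by move: (T * l) (_ ^+ k) => u v; nra.
Qed.

(** The error is estimated relative to [rhoG], whose decay must be kept for summability. With
    [x = dt * l], the quotient of the exponential by [rhoG] is at least the exponential of
    [2 * k * (x - x^2) - 2 * l * T]. *)
Lemma rhoGB_exp_le T dt l k :
  0 < dt -> 0 < l -> k%:R * dt <= T -> T <= (k%:R + 1) * dt ->
  rhoG dt l k - expR (- (2 * l * T)) <=
  rhoG dt l k * (2 * dt * l * (1 + T * l)).
Proof.
move=> dt0 l0 kT Tk; set E := expR _.
have x0 : 0 < dt * l by rewrite mulr_gt0.
have x1 : 0 < 1 + dt * l by rewrite addr_gt0.
have G0 : 0 < rhoG dt l k by rewrite invr_gt0 exprn_gt0.
suff : 1 - 2 * dt * l * (1 + T * l) <= E / rhoG dt l k.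
  by rewrite ler_pdivlMr // => h; lra.
rewrite /rhoG invrK; set x := dt * l in x0 x1 *.
(* Inverse of [exp(-y) >= 1 - y] at [y = x / (1 + x)], where [1 - y = 1 / (1 + x)]. *)
have y1 : expR (x / (1 + x)) <= 1 + x.
  have := expR_ge1Dx (- (x / (1 + x))).
  rewrite expRN (_ : 1 + _ = (1 + x)^-1); last by field; rewrite gt_eqF.
  by rewrite lef_pV2 ?posrE ?expR_gt0.
apply: (@le_trans _ _ (E * expR (x / (1 + x)) ^+ (2 * k))); last first.
  by rewrite ler_wpM2l ?expR_ge0 // lerXn2r ?nnegrE ?expR_ge0 // ltW.
rewrite -expRM_natl /E -expRD natrM; apply: le_trans (expR_ge1Dx _).
have yx : x - x ^+ 2 <= x / (1 + x).
  rewrite ler_pdivlMr //.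
  by have := exprn_gt0 3 x0; lra.
have kyx : k%:R * (x - x ^+ 2) <= k%:R * (x / (1 + x)) by apply: ler_wpM2l.
have kx : l * (T - dt) <= k%:R * x.
  by have : l * (T - dt) <= l * (k%:R * dt); [rewrite ler_pM2l //; lra|rewrite /x; lra].
have kx2 : k%:R * x ^+ 2 <= T * dt * l ^+ 2.
  have h : 0 <= dt * l ^+ 2 by rewrite mulr_ge0 ?sqr_ge0 // ltW.
  have := ler_wpM2r h kT; rewrite /x; lra.
rewrite /x in kx kx2 kyx *; lra.
Qed.

Lemma vEuler_ge0 dt k n : 0 < dt -> 0 <= vEuler dt k n.
Proof.
move=> dt0; have l0 : 0 <= lam n by rewrite mulr_ge0 ?sqr_ge0.
rewrite mulr_ge0 ?sumr_ge0 // ?ltW // => l _.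
by rewrite exprn_ge0 // invr_ge0 addr_ge0 // mulr_ge0 // ltW.
Qed.

(** The first term is the error of the stationary variances [1 / (2 l)] and [1 / (2 l + dt * l^2)],
    the second that of the factors by which the two dynamics forget the initial value. Both are
    nonnegative when [k * dt <= T]. *)
Lemma qTB_vEulerE T dt k n : 0 < dt -> (0 < n)%N ->
  qT T n - vEuler dt k n =
  (1 - expR (- (2 * lam n * T))) * (dt / (4 + 2 * (dt * lam n))) +
  (rhoG dt (lam n) k - expR (- (2 * lam n * T))) / (2 * lam n + dt * lam n ^+ 2).
Proof.
move=> dt0 n0; rewrite vEulerE // /qT; have l0 := lam_gt0 n0.
move: (expR _) (rhoG _ _ _) => E G; move: (lam n) l0 => l l0.
have h1 : 0 < dt * l by rewrite mulr_gt0.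
have h2 : 0 < dt * l ^+ 2 by rewrite mulr_gt0 // exprn_gt0.
field; rewrite !gt_eqF //; lra.
Qed.

Lemma exp_lam_le1 T l : 0 <= T -> 0 <= l -> expR (- (2 * l * T)) <= 1 :> R.
Proof. by move=> T0 l0; rewrite -expR0 ler_expR oppr_le0 !mulr_ge0. Qed.

Lemma vEuler_le_qT T dt k n : 0 < T -> 0 < dt -> (0 < n)%N -> k%:R * dt <= T ->
  vEuler dt k n <= qT T n.
Proof.
move=> T0 dt0 n0 kT; have l0 := lam_gt0 n0; have dl0 : 0 < dt * lam n by rewrite mulr_gt0.
rewrite -subr_ge0 qTB_vEulerE //; apply: addr_ge0.
  apply: mulr_ge0; first by rewrite subr_ge0 exp_lam_le1 // ltW.
  by rewrite divr_ge0 ?ltW // addr_gt0 // mulr_gt0.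
apply: divr_ge0; first by rewrite subr_ge0 rhoG_ge_exp.
by rewrite ltW // addr_gt0 // mulr_gt0 // exprn_gt0.
Qed.

(** Summed over [n], the first term is of order [sqrt dt] and the second only of order [dt]. *)
Lemma qTB_vEuler_le T dt k n : 0 < dt -> dt <= T / 2 -> (0 < n)%N ->
  k%:R * dt <= T -> T <= (k%:R + 1) * dt ->
  qT T n - vEuler dt k n <=
  dt / (4 + 2 * (dt * lam n)) + dt * (4 / T ^+ 2 + 4 / T) / n%:R ^+ 2.
Proof.
move=> dt0 dtT n0 kT Tk; have T0 : 0 < T by lra.
rewrite qTB_vEulerE //; have l0 := lam_gt0 n0; have l1 := lam_ge1 n0.
have ln : n%:R ^+ 2 <= lam n by have := lam_ge n; have := sqr_ge0 (n%:R : R); lra.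
have nR : 0 < n%:R :> R by rewrite ltr0n.
have GE := rhoG_ge_exp dt0 l0 kT; have GB := rhoGB_exp_le dt0 l0 kT Tk.
have Gle := rhoG_le dt0 l0 dtT Tk.
move: (lam n) l0 l1 ln GE GB Gle => l l0 l1 ln GE GB Gle.
have dl0 : 0 < dt * l by rewrite mulr_gt0.
have dl2 : 0 < dt * l ^+ 2 by rewrite mulr_gt0 ?exprn_gt0.
apply: lerD.
  rewrite -[leRHS]mul1r; apply: ler_wpM2r; last by have := expR_ge0 (- (2 * l * T)); lra.
  by rewrite divr_ge0 ?ltW // addr_gt0 // mulr_gt0.
apply: (@le_trans _ _ (rhoG dt l k * (2 * dt * l * (1 + T * l)) / (2 * l))).
  apply: ler_pM => //; rewrite ?subr_ge0 // ?invr_ge0; first by lra.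
  by rewrite lef_pV2 ?posrE; lra.
rewrite [leLHS](_ : _ = rhoG dt l k * (dt * (1 + T * l))); last by field; rewrite gt_eqF.
apply: (@le_trans _ _ (4 / (T * l) ^+ 2 * (dt * (1 + T * l)))).
  apply: ler_wpM2r => //.
  by rewrite mulr_ge0 ?ltW // addr_gt0 ?mulr_gt0.
rewrite [leLHS](_ : _ = dt * ((4 / T ^+ 2 / l + 4 / T) * l^-1)); last first.
  by field; rewrite !gt_eqF.
rewrite -(mulrA dt); apply: ler_wpM2l; first exact: ltW.
have T2 : 0 < 4 / T ^+ 2 by rewrite divr_gt0 ?exprn_gt0.
have T1 : 0 < 4 / T by rewrite divr_gt0.
apply: ler_pM.
- by rewrite addr_ge0 ?ltW // divr_gt0.
- by rewrite invr_ge0 ltW.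
- by rewrite lerD2r ler_pdivrMr // ler_peMr // ltW.
- by rewrite lef_pV2 ?posrE ?exprn_gt0.
Qed.

(** The stationary variance appears times a factor that stays away from 1 as soon as [dt * lam n] is
    bounded below. *)
Lemma vEuler_le dt k n : 0 < dt -> (0 < n)%N ->
  vEuler dt k n <= (2 * lam n)^-1 * (2 / (2 + dt * lam n)).
Proof.
move=> dt0 n0; rewrite vEulerE //; have l0 := lam_gt0 n0.
have G0 : 0 <= rhoG dt (lam n) k.
  by rewrite invr_ge0 exprn_ge0 // addr_ge0 // mulr_ge0 ?ltW.
move: (lam n) l0 G0 => l l0 G0.
have dl0 : 0 < dt * l by rewrite mulr_gt0.
have dl2 : 0 < dt * l ^+ 2 by rewrite mulr_gt0 ?exprn_gt0.
rewrite [leRHS](_ : _ = 1 / (2 * l + dt * l ^+ 2)); last first.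
  by field; rewrite !gt_eqF //; lra.
by apply: ler_wpM2r; [rewrite invr_ge0; lra|lra].
Qed.

End Eigenvalues.

(** * Rates for the two discretizations *)

Section Rates.
Context (R : realType) d (Omega : measurableType d) (P : probability Omega R).
Variables (xi : nat -> Omega -> R) (T : R) (Y : Omega -> R -> R).
Hypotheses (T0 : 0 < T) (iid_xi : iid_std_normal P xi).
Hypothesis vY : series_version P xi (qT T) Y.
Local Notation sqr_bound := (@sqr_bound R).
Local Notation prob_half_one := (@prob_half_one R).
Local Notation lam := (@lam R).

Lemma qT_ge0 n : 0 <= qT T n.
Proof.
have l0 : 0 <= lam n by rewrite mulr_ge0 ?sqr_ge0.
apply: divr_ge0; last by rewrite mulr_ge0.
by rewrite subr_ge0; apply: exp_lam_le1 => //; exact: ltW.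
Qed.

(** Writes the truncation as another series in the same [xi], so that the bounds for pairs of series
    apply. *)
Definition qT_trunc (N n : nat) : R := if (n <= N)%N then qT T n else 0.

Lemma psum_version N : series_version P xi (qT_trunc N) (psum (qT T) xi N).
Proof.
apply: aeW => w; split; first exact: fsum_inH.
have psum_eq M : (N <= M)%N -> psum (qT_trunc N) xi M w = psum (qT T) xi N w.
  move=> NM; apply/funext => x; rewrite /psum (@big_cat_nat _ _ _ N.+1 1 M.+1) //=.
  rewrite [X in _ + X]big_nat [X in _ + X]big1 ?addr0; last first.
    by move=> n /andP[Nn _]; rewrite /qT_trunc leqNgt Nn /= sqrtr0 !mul0r.
  by apply: eq_big_nat => n /andP[_ nN]; rewrite /qT_trunc -ltnS nN.
apply/cvgrPdist_le => e e0; exists N => // M /= NM.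
by rewrite psum_eq // psumE L2dist_fsum big1 ?sqrtr0 ?subr0 ?normr0 ?ltW // => n _;
  rewrite subrr expr0n.
Qed.

Lemma spectral_upper N : (0 < N)%N ->
  dBL P Y (psum (qT T) xi N) <= (sqr_bound + 1) * Num.sqrt N%:R^-1.
Proof.
move=> N0; have NR : 0 < N%:R :> R by rewrite ltr0n.
apply: (dBL_upper iid_xi _ vY (psum_version N)); first by rewrite invr_gt0.
move=> M; apply: le_trans (sum_inv_sqr_le R M N0).
apply: ler_sum_nat => n /andP[n0 _]; rewrite /qT_trunc; case: ifP => _.
  by rewrite subrr expr0n.
rewrite sqrtr0 subr0 sqr_sqrtr ?qT_ge0 //.
exact: le_trans (qT_le _ n0) (inv_lam_le _ n0).
Qed.

(** From [2 * lam (2 * N) = 8 * pi^2 * N^2], the worst case among the modes up to [2 * N]. *)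
Definition lam_scale : R := Num.sqrt ((8 * pi ^+ 2)^-1).

Lemma sqrt_inv_lam n N : (0 < N)%N -> (n <= 2 * N)%N -> (0 < n)%N ->
  lam_scale / N%:R <= Num.sqrt (2 * lam n)^-1.
Proof.
move=> N0 nN n0; have NR : 0 < N%:R :> R by rewrite ltr0n.
rewrite -(ger0_norm (ltW NR)) -sqrtr_sqr -sqrtrV ?sqr_ge0 // -sqrtrM; last first.
  by rewrite invr_ge0 mulr_ge0 ?sqr_ge0.
have p2 : 0 < pi ^+ 2 :> R by rewrite exprn_gt0 ?pi_gt0.
apply: ler_wsqrtr; rewrite -invfM lef_pV2 ?posrE.
- by have := lam_le R nN; rewrite {2}/lam natrM; lra.
- by apply: mulr_gt0; [apply: mulr_gt0|rewrite exprn_gt0].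
- by rewrite mulr_gt0 // lam_gt0.
Qed.

Lemma lam_scale_gt0 : 0 < lam_scale.
Proof. by rewrite sqrtr_gt0 invr_gt0 mulr_gt0 // exprn_gt0 // pi_gt0. Qed.

Lemma sqrt_mul_inv (N : nat) (c : R) : (0 < N)%N ->
  Num.sqrt N%:R * (c / N%:R) = c * Num.sqrt N%:R^-1.
Proof.
move=> N0; have NR : 0 < N%:R :> R by rewrite ltr0n.
rewrite sqrtrV ?ler0n // -[in X in c / X](sqr_sqrtr (ltW NR)).
by field; rewrite sqrtr_eq0 -ltNge.
Qed.

Lemma spectral_lower : exists2 c : R, 0 < c &
  forall N, (0 < N)%N -> c * Num.sqrt N%:R^-1 <= dBL P Y (psum (qT T) xi N).
Proof.
(* The mode 1 has the slowest relaxation, so this fraction of the stationary variance is reached in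
   every mode. *)
pose kappa : R := 1 - expR (- (2 * lam 1 * T)).
have l1 : 0 < lam 1 by exact: lam_gt0.
have k0 : 0 < kappa.
  by rewrite subr_gt0 -expR0 ltr_expR oppr_lt0; apply: mulr_gt0 => //; apply: mulr_gt0.
exists (Num.sqrt kappa * lam_scale * prob_half_one / 4).
  have c10 := lam_scale_gt0; have p00 := prob_half_one_gt0 R.
  have sk0 : 0 < Num.sqrt kappa by rewrite sqrtr_gt0.
  by rewrite divr_gt0 // mulr_gt0 // mulr_gt0.
move=> N N0; have NR : 0 < N%:R :> R by rewrite ltr0n.
pose delta := Num.sqrt kappa * lam_scale / N%:R.
(* The block is [N+1, ..., 2N]: the first modes lost by truncation, so the gap is the full standard
   deviation. *)
have := @dBL_lower _ _ _ _ _ iid_xi N.+1 N _ _ _ _ delta isT N0 _ vY (psum_version N) _ _.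
rewrite /delta sqrt_mul_inv // => low.
apply: le_trans (low _ _ _).
- by rewrite le_eqVlt; apply/orP; left; apply/eqP; ring.
- by rewrite divr_ge0 ?mulr_ge0 ?sqrtr_ge0 // ltW.
- by move=> n /andP[Nn _]; apply: sqrt_qT_le => //; exact: ltnW.
move=> n /andP[Nn n2N]; have n0 : (0 < n)%N := leq_trans (ltn0Sn N) Nn.
rewrite /qT_trunc leqNgt Nn /= sqrtr0 add0r.
apply: (@le_trans _ _ (Num.sqrt (kappa / (2 * lam n)))).
  rewrite (sqrtrM _ (ltW k0)) -mulrA; apply: ler_wpM2l; first exact: sqrtr_ge0.
  by apply: sqrt_inv_lam => //; rewrite mul2n -addnn -ltnS -addSn.
apply: ler_wsqrtr; apply: qT_ge => //.
rewrite /kappa opprB addrCA subrr addr0 ler_expR lerN2.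
apply: ler_wpM2r; first exact: ltW.
by rewrite ler_pM2l // lam_le.
Qed.

(** * Fourth-root bounds for the Euler scheme *)

Section Euler.
Variables (Z : R -> Omega -> R -> R).
Hypothesis vZ : forall dt : R, 0 < dt < 1 ->
  series_version P xi (vEuler dt (Num.truncn (T / dt))) (Z dt).

Lemma truncn_bounds (dt : R) : 0 < dt ->
  (Num.truncn (T / dt))%:R * dt <= T /\ T <= ((Num.truncn (T / dt))%:R + 1) * dt.
Proof.
move=> dt0; have Td : 0 <= T / dt by rewrite divr_ge0 // ltW.
have /andP[h1 h2] := truncn_itv Td.
by split; [rewrite -ler_pdivlMr|rewrite -ler_pdivrMr // natr1 ltW].
Qed.

Lemma euler_upper : exists2 C : R, 0 < C & forall dt : R, 0 < dt < 1 -> dt <= T / 2 ->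
  dBL P Y (Z dt) <= C * Num.sqrt (Num.sqrt dt).
Proof.
pose c : R := 4 / T ^+ 2 + 4 / T.
have c0 : 0 < c by rewrite addr_gt0 // divr_gt0 // exprn_gt0.
exists ((sqr_bound + 1) * Num.sqrt (1 + 2 * c)).
  apply: mulr_gt0; first by rewrite ltr_wpDl // sqr_bound_ge0.
  by rewrite sqrtr_gt0; lra.
move=> dt dt1 dtT; have /andP[dt0 dtl1] := dt1; have [kT Tk] := truncn_bounds dt0.
set k := Num.truncn _ in kT Tk; pose h : R := Num.sqrt dt.
have h0 : 0 < h by rewrite sqrtr_gt0.
have hh : h ^+ 2 = dt by rewrite sqr_sqrtr // ltW.
have dth : dt <= h by rewrite -hh expr2 ger_pMl // -sqrtr1 ler_sqrt // ltW.
rewrite -mulrA -sqrtrM; last by rewrite addr_ge0 // mulr_ge0 // ltW.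
apply: (dBL_upper iid_xi _ vY (vZ dt1)).
  by rewrite mulr_gt0 // addr_gt0 // mulr_gt0.
(* Two discrete primitives, one for each term of the variance error. The first drops by
   [dt / ((1 + h n) (1 + h (n+1)))]; the second uses [dt <= h]. Their value at 0 is
   [h * (1 + 2 * c)]. *)
move=> M; pose f (n : nat) : R := h / (1 + h * n%:R) + h * c * 2 / (n%:R + 1).
have f0 n : 0 <= f n.
  rewrite addr_ge0 // divr_ge0 ?addr_ge0 ?mulr_ge0 // ?ltW //.
apply: (@le_trans _ _ (f 0%N - f M)); last first.
  have -> : f 0%N = h + h * c * 2 by rewrite /f mulr0 addr0 add0r !divr1.
  by have := f0 M; rewrite -/h; lra.
apply: sum_le_telescope => n.
have n0 : (0 < n.+1)%N by [].
apply: le_trans (sqr_sqrtB_le (vEuler_ge0 _ _ dt0) (vEuler_le_qT T0 dt0 n0 kT)) _.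
apply: le_trans (qTB_vEuler_le dt0 dtT n0 kT Tk) _; rewrite -/c /f.
have lamn := lam_ge R n.+1; have nR : 0 <= n%:R :> R by [].
rewrite -[n.+1%:R]natr1 in lamn *; move: (n%:R) nR (lam _) lamn => x x0 l lx.
have hx : 0 <= h * x by rewrite mulr_ge0 // ltW.
have A1 : dt / (4 + 2 * (dt * l)) <= h / (1 + h * x) - h / (1 + h * (x + 1)).
  rewrite (_ : h / _ - _ = dt / ((1 + h * x) * (1 + h * (x + 1)))); last first.
    by rewrite -hh; field; rewrite !gt_eqF //; lra.
  apply: ler_wpM2l; first exact: ltW.
  rewrite lef_pV2 ?posrE; last 2 first.
  - have l0 : 0 <= l by have := sqr_ge0 (x + 1); lra.
    have : 0 <= dt * l by apply: mulr_ge0 => //; exact: ltW.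
    by lra.
  - by rewrite mulr_gt0 //; lra.
  have : h ^+ 2 * (4 * (x + 1) ^+ 2) <= dt * l by rewrite hh ler_wpM2l // ltW.
  have : 0 <= h ^+ 2 * x by rewrite mulr_ge0 // sqr_ge0.
  (* With [y = h * (x + 1)]: the product is at most [(1 + y)^2 <= 2 + 2 * y^2], while
     [dt * l >= 4 * y^2]. *)
  have := sqr_ge0 (h * (x + 1) - 1); have := sqr_ge0 (h * (x + 1)); nra.
have A2 : dt * c / (x + 1) ^+ 2 <= h * c * 2 / (x + 1) - h * c * 2 / (x + 1 + 1).
  rewrite (_ : h * c * 2 / _ - _ = h * c * (2 / ((x + 1) * (x + 1 + 1)))); last first.
    by field; rewrite !gt_eqF //; lra.
  apply: ler_pM.
  - by rewrite mulr_ge0 ?ltW.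
  - by rewrite invr_ge0 sqr_ge0.
  - by rewrite ler_pM2r.
  - rewrite -[leLHS]mul1r ler_pdivrMr ?exprn_gt0 //; last lra.
    rewrite (_ : 2 / _ * _ = 2 * (x + 1) / (x + 1 + 1)); last by field; rewrite !gt_eqF //; lra.
    by rewrite ler_pdivlMr; lra.
by lra.
Qed.

Lemma euler_lower : exists2 c : R, 0 < c & forall dt : R, 0 < dt < 1 -> dt <= T / 2 ->
  c * Num.sqrt (Num.sqrt dt) <= dBL P Y (Z dt).
Proof.
exists (lam_scale / 5 * prob_half_one / 4 * Num.sqrt 2^-1).
  by rewrite !mulr_gt0 ?invr_gt0 ?lam_scale_gt0 ?prob_half_one_gt0 ?sqrtr_gt0.
move=> dt dt1 dtT; have /andP[dt0 dtl1] := dt1; have [kT Tk] := truncn_bounds dt0.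
set k := Num.truncn _ in kT Tk; pose h : R := Num.sqrt dt.
have h0 : 0 < h by rewrite sqrtr_gt0.
have hh : h ^+ 2 = dt by rewrite sqr_sqrtr // ltW.
have h1 : h < 1 by rewrite -sqrtr1 ltr_sqrt.
(* Gives [1 <= N * h <= 2]: the left bound makes [dt * lam n >= 4] on the block [N, ..., 2N - 1],
   the right one yields [1 / N >= h / 2], hence the factor [sqrt (1/2)]. *)
pose N := (Num.truncn h^-1).+1.
have /andP[hN1 hN2] : (Num.truncn h^-1)%:R <= h^-1 < N%:R.
  by apply: truncn_itv; rewrite invr_ge0 ltW.
have N0 : (0 < N)%N by [].
have NR : 0 < N%:R :> R by [].
have Nh : 1 <= N%:R * h by rewrite -ler_pdivrMr // div1r ltW.
have Nh2 : N%:R * h <= 2.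
  rewrite -ler_pdivlMr // /N -natr1.
  have : h^-1 * h = 1 by rewrite mulVf // gt_eqF.
  by rewrite -[leRHS]mulrC -ler_pdivrMl ?invr_gt0 // invrK; nra.
(* The 5 comes from the gap [4/5 - 3/5]. Relative to [1 / (2 lam n)] the Euler variance is at most
   [1/3 <= (3/5)^2], the exact one at least [3/4 >= (4/5)^2]. *)
pose delta := lam_scale / 5 / N%:R.
have low := @dBL_lower _ _ _ _ _ iid_xi N N _ _ _ _ delta N0 N0 _ vY (vZ dt1) _ _.
rewrite /delta sqrt_mul_inv // in low.
apply: le_trans (low _ _ _).
- rewrite -mulrA -sqrtrM // [leRHS](_ : _ =
    lam_scale / 5 * prob_half_one / 4 * Num.sqrt N%:R^-1); last by ring.
  apply: ler_wpM2l; first by rewrite !mulr_ge0 ?invr_ge0 ?ltW ?lam_scale_gt0 ?prob_half_one_gt0.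
  apply: ler_wsqrtr; rewrite -/h -[leRHS]mul1r ler_pdivlMr //; lra.
- by rewrite !mulr_ge0 ?invr_ge0 ?sqrtr_ge0 ?ltW.
- by move=> n /andP[Nn _]; apply: sqrt_qT_le.
move=> n /andP[Nn n2N]; have n0 : (0 < n)%N := leq_trans N0 Nn.
have l0 := lam_gt0 R n0.
have NnR : N%:R <= n%:R :> R by rewrite ler_nat.
have x4 : 4 <= dt * lam n.
  have : dt * (4 * n%:R ^+ 2) <= dt * lam n by rewrite ler_pM2l // lam_ge.
  have : 1 <= (n%:R * h) ^+ 2.
    by rewrite -[leLHS](expr1n _ 2) lerXn2r ?nnegrE ?mulr_ge0 ?(ltW h0) // (le_trans Nh) // ler_pM2r.
  by rewrite exprMn hh; lra.
have li0 : 0 <= (2 * lam n)^-1 by rewrite invr_ge0 mulr_ge0 // ltW.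
have ub : Num.sqrt (vEuler dt k n) <= 3 / 5 * Num.sqrt (2 * lam n)^-1.
  rewrite -(ger0_norm (_ : 0 <= 3 / 5)) // -sqrtr_sqr -sqrtrM ?sqr_ge0 //.
  apply: ler_wsqrtr; apply: le_trans (vEuler_le _ dt0 n0) _.
  rewrite mulrC; apply: ler_wpM2r => //.
  by rewrite ler_pdivrMr; lra.
have lb : 4 / 5 * Num.sqrt (2 * lam n)^-1 <= Num.sqrt (qT T n).
  rewrite -(ger0_norm (_ : 0 <= 4 / 5)) // -sqrtr_sqr -sqrtrM ?sqr_ge0 //.
  apply: ler_wsqrtr; apply: (qT_ge n0).
  have lT : 3 <= 2 * lam n * T.
    have : dt * lam n <= T / 2 * lam n by rewrite ler_pM2r.
    by lra.
  apply: (@le_trans _ _ (4^-1)); last lra.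
  rewrite expRN lef_pV2 ?posrE ?expR_gt0 //.
  by have := expR_ge1Dx (2 * lam n * T); lra.
have : lam_scale / N%:R <= Num.sqrt (2 * lam n)^-1.
  by apply: sqrt_inv_lam => //; rewrite mul2n -addnn ltnW.
rewrite mulrAC; lra.
Qed.

End Euler.
End Rates.

(** * Limits superior *)

Section Limsup.
Context (R : realType) (U : choiceType) (X : filteredType U).
Variables (F : set_system X) (f : X -> R).
Context {FF : ProperFilter F}.

Lemma limf_esup_eq0 : (forall e, 0 < e -> F [set x | 0 <= f x <= e]) ->
  limf_esup (fun x => (f x)%:E) F = 0%E.
Proof.
move=> f_le; apply/eqP; rewrite eq_le; apply/andP; split.
  apply/lee_addgt0Pr => e e0; rewrite add0e.
  apply: (@le_trans _ _ (ereal_sup ((fun x => (f x)%:E) @` [set x | 0 <= f x <= e]))).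
    by apply: ereal_inf_lbound; exists [set x | 0 <= f x <= e] => //; exact: f_le.
  by apply: ge_ereal_sup => _ [x /andP[_ fe] <-]; rewrite lee_fin.
apply: le_ereal_inf_tmp => _ [V FV <-].
have [x [Vx /andP[fx0 _]]] : V `&` [set x | 0 <= f x <= 1] !=set0.
  exact: (filter_ex (filterI FV (f_le _ ltr01))).
by apply: le_ereal_sup_tmp; exists (f x)%:E; [exists x|rewrite lee_fin].
Qed.

Lemma limf_esup_eqy : (forall A, F [set x | A <= f x]) ->
  limf_esup (fun x => (f x)%:E) F = +oo%E.
Proof.
move=> f_ge; apply: eq_infty => A; apply: le_ereal_inf_tmp => _ [V FV <-].
have [x [Vx fx]] : V `&` [set x | A <= f x] !=set0.
  exact: (filter_ex (filterI FV (f_ge A))).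
by apply: le_ereal_sup_tmp; exists (f x)%:E; [exists x|rewrite lee_fin].
Qed.

End Limsup.

(** * Powers of a small parameter against its fourth root *)

Section Powers.
Context (R : realType).
Implicit Types (t r : R).

Lemma powRV_mul_sqrt2 t r : 0 < t ->
  (t `^ r)^-1 * Num.sqrt (Num.sqrt t) = t `^ (1 / 4 - r).
Proof.
move=> t0; rewrite -powR12_sqrt ?sqrtr_ge0 // -powR12_sqrt ?ltW // -powRrM.
rewrite -powRN -powRD; last by rewrite (gt_eqF t0) implybT.
by congr (_ `^ _); field.
Qed.

Lemma powR_le_of_le t a e : 0 < a -> 0 < e -> 0 < t -> t <= e `^ a^-1 -> t `^ a <= e.
Proof.
move=> a0 e0 t0 te; have -> : e = (e `^ a^-1) `^ a.
  by rewrite -powRrM mulVf ?gt_eqF // powRr1 // ltW.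
by apply: ge0_ler_powR; rewrite ?nnegrE ?powR_ge0 // ltW.
Qed.

Lemma upper_rate_small r C e : r < 1 / 4 -> 0 < C -> 0 < e ->
  exists2 delta : R, 0 < delta & forall t, 0 < t -> t <= delta ->
    (t `^ r)^-1 * (C * Num.sqrt (Num.sqrt t)) <= e.
Proof.
move=> r4 C0 e0; have a0 : 0 < 1 / 4 - r by rewrite subr_gt0.
have eC : 0 < e / C by rewrite divr_gt0.
exists ((e / C) `^ (1 / 4 - r)^-1) => [|t t0 te]; first exact: powR_gt0.
rewrite mulrCA powRV_mul_sqrt2 // mulrC -ler_pdivlMr //.
exact: powR_le_of_le.
Qed.

Lemma lower_rate_large r c A : 1 / 4 < r -> 0 < c ->
  exists2 delta : R, 0 < delta & forall t, 0 < t -> t <= delta ->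
    A <= (t `^ r)^-1 * (c * Num.sqrt (Num.sqrt t)).
Proof.
move=> r4 c0; pose B := Num.max A 1; have B0 : 0 < B by rewrite lt_max ltr01 orbT.
have a0 : 0 < r - 1 / 4 by rewrite subr_gt0.
have cB : 0 < c / B by rewrite divr_gt0.
exists ((c / B) `^ (r - 1 / 4)^-1) => [|t t0 te]; first exact: powR_gt0.
apply: (@le_trans _ _ B); first by rewrite le_max lexx.
rewrite mulrCA powRV_mul_sqrt2 // -opprB powRN ler_pdivlMr ?powR_gt0 //.
by rewrite mulrC -ler_pdivlMr //; exact: powR_le_of_le.
Qed.

End Powers.

(** * From two-sided fourth-root bounds to the limits superior *)

Section Assembly.
Context (R : realType) (X : choiceType) (U : filteredType X) (F : set_system U).
Context {FF : ProperFilter F}.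
Variables (t D : U -> R) (c C : R).
Hypotheses (c0 : 0 < c) (C0 : 0 < C).
Hypothesis t_small : forall delta, 0 < delta -> F [set x | 0 < t x <= delta].
Hypothesis D_bounds : F [set x |
  c * Num.sqrt (Num.sqrt (t x)) <= D x <= C * Num.sqrt (Num.sqrt (t x))].

Lemma limf_esup_rate0 r : r < 1 / 4 ->
  limf_esup (fun x => ((t x `^ r)^-1 * D x)%:E) F = 0%E.
Proof.
move=> r4; apply: limf_esup_eq0 => e e0.
have [delta d0 small] := upper_rate_small r4 C0 e0.
apply: filterS (filterI D_bounds (t_small d0)) => x [/andP[lo up] /andP[tx0 txd]] /=.
apply/andP; split.
  rewrite mulr_ge0 ?invr_ge0 ?powR_ge0 // (le_trans _ lo) // mulr_ge0 ?sqrtr_ge0 //.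
  exact: ltW.
apply: le_trans (small _ tx0 txd); apply: ler_wpM2l => //.
by rewrite invr_ge0 powR_ge0.
Qed.

Lemma limf_esup_ratey r : 1 / 4 < r ->
  limf_esup (fun x => ((t x `^ r)^-1 * D x)%:E) F = +oo%E.
Proof.
move=> r4; apply: limf_esup_eqy => A.
have [delta d0 large] := lower_rate_large A r4 c0.
apply: filterS (filterI D_bounds (t_small d0)) => x [/andP[lo up] /andP[tx0 txd]] /=.
apply: le_trans (large _ tx0 txd) _; apply: ler_wpM2l => //.
by rewrite invr_ge0 powR_ge0.
Qed.

End Assembly.

Lemma powRVl (R : realType) (x r : R) : 0 <= x -> x `^ r = (x^-1 `^ r)^-1.
Proof.
by move=> x0; rewrite -powRN -(powR_inv1 x0) -powRrM mulrNN mul1r.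
Qed.

(** As [sqrt (lam N) = pi * N], the rate [N^(-1/2)] is a fourth root of [1 / lam N]; this puts the
    truncation in the same form as the Euler scheme. *)
Lemma sqrt_inv_nat (R : realType) (N : nat) : (0 < N)%N ->
  Num.sqrt (N%:R^-1 : R) = Num.sqrt pi * Num.sqrt (Num.sqrt (lam N)^-1).
Proof.
move=> N0; have NR : 0 < N%:R :> R by rewrite ltr0n.
have p0 := pi_gt0 R.
rewrite -sqrtrM ?ltW //; congr Num.sqrt.
rewrite /lam -exprMn -exprVn sqrtr_sqr ger0_norm; last by rewrite invr_ge0 mulr_ge0 ?ltW.
by move: (pi : R) p0 => p p0; field; rewrite !gt_eqF.
Qed.

Theorem theorem3p2 (R : realType) (d : measure_display) (Omega : measurableType d)
    (P : probability Omega R) (xi : nat -> Omega -> R) (T : R)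
    (Y : Omega -> R -> R) (Z : R -> Omega -> R -> R) :
  0 < T ->
  iid_std_normal P xi ->
  (* Y realizes X(T), whose law is mu_T *)
  series_version P xi (qT T) Y ->
  (* Z dt realizes X^dt_k with k = floor(T/dt), whose law is nu_k^dt *)
  (forall dt : R, 0 < dt < 1 ->
     series_version P xi (vEuler dt (Num.truncn (T / dt))) (Z dt)) ->
  (* psum (qT T) xi N realizes X^(N)(T) = P_N X(T), whose law is mu_T^(N) *)
  ((forall r : R, 0 <= r < 1 / 4 ->
      limn_esup (fun N : nat =>
        ((lam N) `^ r * dBL P Y (psum (qT T) xi N))%:E) = 0%E) /\
   (forall r : R, 1 / 4 < r < 1 / 2 ->
      limn_esup (fun N : nat =>
        ((lam N) `^ r * dBL P Y (psum (qT T) xi N))%:E) = +oo%E)) /\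
  ((forall r : R, 0 <= r < 1 / 4 ->
      limf_esup (fun dt : R => ((dt `^ r)^-1 * dBL P Y (Z dt))%:E) (0%R)^'+
        = 0%E) /\
   (forall r : R, 1 / 4 < r < 1 / 2 ->
      limf_esup (fun dt : R => ((dt `^ r)^-1 * dBL P Y (Z dt))%:E) (0%R)^'+
        = +oo%E)).

Proof.
move=> T0 iid_xi vY vZ.
have K20 := sqr_bound_ge0 R; have sp0 : 0 < Num.sqrt (pi : R) by rewrite sqrtr_gt0 pi_gt0.
split.
  have [c c0 low] := spectral_lower T0 iid_xi vY.
  have tN delta : 0 < delta -> \oo [set N | 0 < (@lam R N)^-1 <= delta].
    (* Beyond this index [lam N >= 4 * N^2 >= N >= 1 / delta]. *)
    move=> d0; exists (Num.truncn delta^-1).+1 => // N /= lN.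
    have N0 : (0 < N)%N := leq_trans (ltn0Sn _) lN.
    rewrite invr_gt0 lam_gt0 //= -[leRHS]invrK lef_pV2 ?posrE ?invr_gt0 ?lam_gt0 //.
    have N1 : 1 <= N%:R :> R by rewrite ler1n.
    have Nd : delta^-1 <= N%:R.
      have di0 : 0 <= delta^-1 by rewrite invr_ge0 ltW.
      have /andP[_ /ltW h] := truncn_itv di0.
      by apply: le_trans h _; rewrite ler_nat.
    by have := lam_ge R N; nra.
  have DN : \oo [set N | c * Num.sqrt pi * Num.sqrt (Num.sqrt (lam N)^-1) <=
      dBL P Y (psum (qT T) xi N) <=
      (sqr_bound R + 1) * Num.sqrt pi * Num.sqrt (Num.sqrt (lam N)^-1)].
    exists 1%N => // N /= N0; rewrite -!mulrA -sqrt_inv_nat // low //=.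
    exact: spectral_upper.
  (* Valid at [N = 0] as well, where [lam 0] and its inverse are both 0. *)
  have lamV r : (fun N => ((lam N) `^ r * dBL P Y (psum (qT T) xi N))%:E) =
      (fun N => (((lam N)^-1 `^ r)^-1 * dBL P Y (psum (qT T) xi N))%:E).
    by apply/funext => N; rewrite -powRVl // mulr_ge0 ?sqr_ge0.
  split=> r /andP[r1 r2]; rewrite lamV /limn_esup.
    by apply: (limf_esup_rate0 _ _ tN DN); rewrite ?mulr_gt0 // ltr_wpDl.
  by apply: (limf_esup_ratey _ tN DN); rewrite ?mulr_gt0.
have [c c0 low] := euler_lower T0 iid_xi vY vZ.
have [C C0 up] := euler_upper T0 iid_xi vY vZ.
have tdt delta : 0 < delta -> (0%R)^'+ [set dt : R | 0 < dt <= delta].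
  move=> d0; near=> dt => /=; apply/andP; split; near: dt.
    exact: nbhs_right_gt.
  exact: nbhs_right_le.
have Ddt : (0%R)^'+ [set dt : R | c * Num.sqrt (Num.sqrt dt) <= dBL P Y (Z dt) <=
    C * Num.sqrt (Num.sqrt dt)].
  near=> dt => /=.
  have dt1 : 0 < dt < 1.
    by apply/andP; split; near: dt; [exact: nbhs_right_gt|exact: nbhs_right_lt].
  have dtT : dt <= T / 2.
    by near: dt; apply: nbhs_right_le; rewrite divr_gt0.
  by rewrite low // up.
split=> r /andP[r1 r2].
  exact: (limf_esup_rate0 c0 C0 tdt Ddt).
exact: (limf_esup_ratey c0 tdt Ddt).
Unshelve. all: by end_near. Qed.
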